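(* Let $\mu$ be a finite positive Borel measure on $\mathbb{T}$ and let $E\subset\mathbb{T}$ be an $\mathcal{L}_2$-set. Assume that $$\mu(E_t)=O(h(t))\quad\text{as }t\to0^+,$$ where $h:(0,1)\to(0,\infty)$ is such that $h(t)/t$ is decreasing and $h(t)/t^\beta$ is increasing for some $\beta\in(0,1)$. If $$\int_0^1\frac{dt}{h(t)}=+\infty,$$ then $c_\mu(E)=0$.
   Context: $\mathbb{T}$ is the unit circle, $|d\zeta|$ is arc length measure, $\mathrm{dist}(\zeta,E)$ is the (arc-length) distance, and $E_t=\{\zeta\in\mathbb{T}:\mathrm{dist}(\zeta,E)\le t\}$. Monotonicity is in the wide sense. A Carleson set is a nonempty closed set $E\subset\mathbb{T}$ of zero length measure with $\int_{\mathbb{T}}\log\mathrm{dist}(\zeta,E)\,|d\zeta|>-\infty$. For $\zeta\in\mathbb{T}\setminus E$, $I(\zeta,E)$ is the connected component of $\mathbb{T}\setminus E$ containing $\zeta$, and $\Gamma(\zeta,E)=\{\zeta'\in\mathbb{T}\setminus I(\zeta,E):\mathrm{dist}(\zeta',E)\le\mathrm{dist}(\zeta,E)\}$. A Carleson set $E$ is an $\mathcal{L}_2$-set if there is $C>0$ such that for all $\zeta\in\mathbb{T}\setminus E$ $$\int_{\Gamma(\zeta,E)}\frac{\log^2\big(\mathrm{dist}(\zeta,E)/\mathrm{dist}(\zeta',E)\big)}{|\zeta-\zeta'|^2}\,|d\zeta'|\le\frac{C}{\mathrm{dist}(\zeta,E)}.$$ Capacity: for $f\in L^1(\mathbb{T})$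 let $f^*(\zeta)$ be the nontangential limit at $\zeta$ of its Poisson transform, when it exists, and $\mathcal{D}_\zeta(f)=\frac1{2\pi}\int_{\mathbb{T}}\frac{|f^*(\xi)-f^*(\zeta)|^2}{|\xi-\zeta|^2}|d\xi|$ ($=\infty$ if $f^*(\zeta)$ does not exist); $\mathcal{D}_\mu(f)=\int_{\mathbb{T}}\mathcal{D}_\zeta(f)\,d\mu(\zeta)$. The harmonic space $\mathcal{D}^h(\mu)$ is the set of $f\in L^2(\mathbb{T})$ with $\mathcal{D}_\mu(f)<\infty$, with norm $\|f\|_\mu^2=|f(0)|^2+\mathcal{D}_\mu(f)$, where $f(0)$ is the value at $0$ of the Poisson transform. For $U\subset\mathbb{T}$ open, $c_\mu(U)=\inf\{\|f\|_\mu^2:f\in\mathcal{D}^h(\mu),\ f\ge0,\ f\ge1\text{ a.e. on }U\}$, and for any $F\subset\mathbb{T}$, $c_\mu(F)=\inf\{c_\mu(U):U\text{ open},\ F\subset U\}$. *)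

(* Defs.v *)
From HB Require Import structures.
From mathcomp Require Import all_boot all_order all_algebra.
From mathcomp Require Import all_classical all_reals all_analysis.
From mathcomp Require Import measurable_realfun.

Set Implicit Arguments.
Unset Strict Implicit.
Unset Printing Implicit Defensive.

Import Order.TTheory GRing.Theory Num.Theory.
Import numFieldNormedType.Exports.

Local Open Scope classical_set_scope.
Local Open Scope ring_scope.

Section circle.
Context {R : realType}.
Implicit Types (z w : R * R) (E U : set (R * R)).

(* The complex plane is R * R with its product topology and product
   sigma-algebra.  The library norm on R * R is the sup norm, hence a separate
   Euclidean modulus. *)
Definition modulus z : R := Num.sqrt (z.1 ^+ 2 + z.2 ^+ 2).

Definition circle : set (R * R) := [set z | modulus z = 1].

Definition circle_open U : Prop := exists2 V, open V & U = circle `&` V.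

(* The angle between z and w, i.e. the length of the shorter arc joining
   them; meaningful for z and w on the circle. *)
Definition arcdist z w : R := acos (z.1 * w.1 + z.2 * w.2).

(* Meaningful for nonempty E, since inf set0 = 0. *)
Definition dist z E : R := inf [set arcdist z w | w in E].

Definition thickening E (t : R) : set (R * R) :=
  [set z | circle z /\ dist z E <= t].

Definition circle_param (t : R) : R * R := (cos t, sin t).

Lemma measurable_circle_param : measurable_fun [set: R] circle_param.
Proof.
apply: measurable_fun_pair; apply: continuous_measurable_fun.
- exact: continuous_cos.
- exact: continuous_sin.
Qed.

Lemma measurable_0_2pi : measurable (`[0, pi *+ 2[%classic : set R).
Proof. exact: measurable_itv. Qed.

(* Arc length as a Borel measure on the plane concentrated on the circle,
   of total mass 2 pi. *)
Definition arclength : set (R * R) -> \bar R :=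
  pushforward (mrestr lebesgue_measure measurable_0_2pi) circle_param.

Let arclength_measure : {measure set (R * R) -> \bar R} :=
  measure_function_pushforward__canonical__measure_function_Measure
    (mrestr lebesgue_measure measurable_0_2pi) measurable_circle_param.

HB.instance Definition _ := isMeasure.Build _ _ _ arclength
  (measure0 arclength_measure) (measure_ge0 arclength_measure)
  (@measure_semi_sigma_additive _ _ _ arclength_measure).

End circle.

Section carleson.
Context {R : realType}.
Implicit Types (z w : R * R) (E : set (R * R)).
Local Open Scope ereal_scope.

(* The value ln 0 = 0 taken at the points of E is harmless: E is a null set. *)
Definition carleson_set E : Prop :=
  [/\ E !=set0, E `<=` circle, closed E, arclength E = 0
    & -oo < \int[arclength]_(z in circle) (ln (dist z E))%:E].

Definition arc_component z E : set (R * R) :=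
  connected_component (circle `\` E) z.

Definition Gamma z E : set (R * R) :=
  [set w | (circle `\` arc_component z E) w /\ (dist w E <= dist z E)%R].

(* At the points w of E, where dist w E = 0, the integrand takes the value 0
   instead of +oo; again E is a null set. *)
Definition L2_set E : Prop :=
  carleson_set E /\
  exists2 C : R, (0 < C)%R & forall z, (circle `\` E) z ->
    \int[arclength]_(w in Gamma z E)
      (ln (dist z E / dist w E) ^+ 2 / modulus (z - w) ^+ 2)%:E
    <= (C / dist z E)%:E.

End carleson.

Section capacity.
Context {R : realType}.
Implicit Types (z w : R * R) (f : R * R -> R).

(* Functions on the circle are represented by functions on the plane; only
   their values on the circle, up to arclength-null sets, matter. *)
Definition poisson f z : R :=
  (pi *+ 2)^-1 * \int[arclength]_(w in circle)
    ((1 - modulus z ^+ 2) / modulus (w - z) ^+ 2 * f w).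

Definition stolz (a : R) z : set (R * R) :=
  [set w | modulus w < 1 /\ modulus (w - z) < a * (1 - modulus w)].

Definition nt_cvg f z (l : R) : Prop :=
  forall a, 1 < a -> poisson f @ within (stolz a z) (nbhs z) --> l.

(* The value f^*(z), set to 0 where the nontangential limit does not exist. *)
Definition nt_lim f z : R := xget 0 [set l | nt_cvg f z l].

Local Open Scope ereal_scope.

Definition local_dirichlet f z : \bar R :=
  if `[< exists l, nt_cvg f z l >] then
    (pi *+ 2)^-1%:E * \int[arclength]_(w in circle)
      (`|nt_lim f w - nt_lim f z| ^+ 2 / modulus (w - z) ^+ 2)%:E
  else +oo.

Definition dirichlet (mu : set (R * R) -> \bar R) f : \bar R :=
  \int[mu]_(z in circle) local_dirichlet f z.

(* The real-valued elements of the harmonic Dirichlet space; the capacity only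
   involves nonnegative ones. *)
Definition harmonic_dirichlet (mu : set (R * R) -> \bar R) f : Prop :=
  f \in Lfun arclength 2%:E /\ dirichlet mu f < +oo.

Definition normsq (mu : set (R * R) -> \bar R) f : \bar R :=
  (`|poisson f (0, 0)| ^+ 2)%:E + dirichlet mu f.

Definition capacity_open (mu : set (R * R) -> \bar R) (U : set (R * R)) :
    \bar R :=
  ereal_inf [set normsq mu f | f in [set f |
    [/\ harmonic_dirichlet mu f, {ae arclength, forall z, (0 <= f z)%R}
      & {ae arclength, forall z, U z -> (1 <= f z)%R}]]].

Definition capacity (mu : set (R * R) -> \bar R) (F : set (R * R)) : \bar R :=
  ereal_inf [set capacity_open mu U | U in [set U |
    circle_open U /\ F `<=` U]].

End capacity.

(* Main.v *)
(** Write [d z] for the distance from [z] to [E] and [a_n = 4^-n / h (4^-n)];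
the weights [a_n] are nonincreasing and have a divergent sum.  The test function
is [F / (3 S)], where [F z = \sum_(m <= n < N) a_n ramp (4^n d z)] and
[S = \sum_(m <= n < N) a_n]: it equals 1 near [E] and tends to 0 off [E] as [N]
grows.  The key estimate is
  [\int |F w - F z|^2 / |w - z|^2 |dw| <= K (\sum_(d z <= 4^(1-n)) a_n^2 4^n + a_m^2 4^m)].
Points [w] with [d w >= d z] are handled by a Hardy-type inequality (a weighted
Cauchy-Schwarz inequality over the dyadic scales).  If [d w < d z], then
[F w - F z] is at most a constant times [A ln (d z / d w)] with [A] the largest
active weight: the part of the circle outside the component of [z] is the
integral bounded by the L2 condition, and inside the component [d] is the
distance to the end points, so that an elementary integral remains.  Integrating
in [z], [mu (E_t) = O(h t)] gives [a_n^2 4^n mu (E_(4^(1-n))) <= C a_n], so the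
energy of the test function is at most [(C S + C_m) / S^2], which tends to 0.
Since the test function is Lipschitz, it is its own nontangential limit. *)

Require Import Defs.
From HB Require Import structures.
From mathcomp Require Import all_boot all_order all_algebra.
From mathcomp Require Import all_classical all_reals all_analysis.
From mathcomp Require Import measurable_realfun ring lra.

Set SsrOldRewriteGoalsOrder.
Set Implicit Arguments.
Unset Strict Implicit.
Unset Printing Implicit Defensive.

Import Order.TTheory GRing.Theory Num.Theory.
Import numFieldNormedType.Exports.

Local Open Scope classical_set_scope.
Local Open Scope ring_scope.

(** * Geometry of the circle *)

(** The weights come from duality. By the bound on [mu], the superposition of ramps with weights
    [a_n] costs about [\sum a_n^2 4^n h (4^-n)], to be compared with [(\sum a_n)^2]; equality in
    Cauchy-Schwarz asks for [a_n] proportional to [4^-n / h (4^-n)], and the sum of these is a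
    dyadic form of the divergent integral of [1 / h]. The monotonicity of [h t / t] acts twice: it
    orders the weights, so that the first scale separating two points carries the largest one, and
    it gives [h (4 t) <= 4 h t], since the ramp of index [n] reaches out to distance [4^(1-n)] while
    its weight is read at [4^-n]. The obstacle is that [E] may leave infinitely many complementary
    arcs: the length of [E_t] need not be [O(t)], and points much closer to [E] than [z] are
    controlled across components by the L2 condition alone. That condition is logarithmic, hence the
    estimates of [F] by logarithms. The norm also contains [|f(0)|^2]. It is made small by fixing a
    scale [p] at which [E_t] is short, and only then letting [N] grow. Scales are powers of 4 so
    that their square roots are powers of 2. *)

Section geometry.
Context {R : realType}.
Implicit Types (z w : R * R) (s t : R).
Local Notation param := (@circle_param R).

Lemma circleE z : circle z <-> z.1 ^+ 2 + z.2 ^+ 2 = 1.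
Proof.
rewrite /circle /= /modulus; split => [h|->]; last by rewrite sqrtr1.
have h0 : 0 <= z.1 ^+ 2 + z.2 ^+ 2 by rewrite addr_ge0// sqr_ge0.
by rewrite -(sqr_sqrtr h0) h expr1n.
Qed.

Lemma circle_circle_param t : circle (param t).
Proof. by apply/circleE; rewrite /= cos2Dsin2. Qed.

Lemma circle_paramDpi2 t : param (t + pi *+ 2) = param t.
Proof. by rewrite /circle_param cosD2pi sinD2pi. Qed.

Lemma circle_paramBpi2 t : param (t - pi *+ 2) = param t.
Proof. by rewrite -circle_paramDpi2 subrK. Qed.

(** The base point [s] is free: a parameter [t] of [z] within [pi] of [s] turns the arc distance to
    [param s] into [|s - t|], and distance questions into questions on the line. *)
Lemma circle_paramP z s : circle z ->
  exists2 t, `|s - t| <= pi & z = param t.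
Proof.
move=> /circleE z1.
(* [(x, y)] is [z] rotated by the angle [- s]; the sign of [y] decides between [acos x] and
   [- acos x]. *)
pose x := z.1 * cos s + z.2 * sin s; pose y := z.2 * cos s - z.1 * sin s.
have cs := cos2Dsin2 s.
have xy1 : x ^+ 2 + y ^+ 2 = 1.
  have -> : x ^+ 2 + y ^+ 2 = (z.1 ^+ 2 + z.2 ^+ 2) * (cos s ^+ 2 + sin s ^+ 2).
    by rewrite /x /y; ring.
  by rewrite z1 cs mul1r.
have x1 : -1 <= x <= 1.
  have : x ^+ 2 <= 1 by rewrite -xy1 lerDl sqr_ge0.
  by rewrite -ler_norml -[_ ^+ 2]real_normK ?num_real// expr_le1.
have y2 : y ^+ 2 = sin (acos x) ^+ 2.
  by rewrite sin2cos2 acosK ?in_itv//=; lra.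
have a0 := acos_ge0 x1; have api := acos_lepi x1.
have [b [b1 cb sb]] : exists b, [/\ `|b| <= pi, cos b = x & sin b = y].
  move/eqP: y2; rewrite eqf_sqr => /orP[] /eqP ->.
    by exists (acos x); rewrite acosK ?in_itv//= ger0_norm.
  by exists (- acos x); rewrite normrN cosN sinN acosK ?in_itv//= ger0_norm.
exists (s + b); first by rewrite opprD addrA subrr add0r normrN.
rewrite /circle_param cosD sinD cb sb (surjective_pairing z).
have e1 : z.1 = z.1 * (cos s ^+ 2 + sin s ^+ 2) by rewrite cs mulr1.
have e2 : z.2 = z.2 * (cos s ^+ 2 + sin s ^+ 2) by rewrite cs mulr1.
by congr pair; [rewrite {1}e1|rewrite {1}e2]; rewrite /x /y /=; ring.
Qed.

Lemma acos_cos s : `|s| <= pi -> acos (cos s) = `|s|.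
Proof.
move=> spi; have [s0|s0] := leP 0 s.
  by rewrite ger0_norm// cosK// in_itv/= s0 -[s]ger0_norm.
rewrite -cosN cosK ?in_itv/=; first by rewrite ltr0_norm.
by rewrite oppr_ge0 ltW//= -(ltr0_norm s0).
Qed.

Lemma arcdist_circle_param s t :
  arcdist (param s) (param t) = acos (cos (s - t)).
Proof. by rewrite /arcdist /= cosB. Qed.

Lemma arcdist_param s t : `|s - t| <= pi ->
  arcdist (param s) (param t) = `|s - t|.
Proof. by move=> st; rewrite arcdist_circle_param acos_cos. Qed.

Lemma arcdist_param_le s t : arcdist (param s) (param t) <= `|s - t|.
Proof.
have [/arcdist_param ->//|h] := leP `|s - t| pi.
by rewrite arcdist_circle_param (le_trans _ (ltW h))// acos_lepi// cos_geN1 cos_le1.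
Qed.

Lemma arcdistC z w : arcdist z w = arcdist w z.
Proof. by rewrite /arcdist mulrC [z.2 * _]mulrC. Qed.

Lemma circle_param_arcdist w s : circle w ->
  exists2 t, w = param t & arcdist (param s) w = `|s - t|.
Proof.
by move=> /(circle_paramP s)[t st ->]; exists t => //; rewrite arcdist_param.
Qed.

Lemma arcdist_ge0 z w : circle z -> circle w -> 0 <= arcdist z w.
Proof.
move=> /(circle_paramP 0)[s _ ->] /(circle_param_arcdist s)[t _ ->].
exact: normr_ge0.
Qed.

Lemma arcdistxx z : circle z -> arcdist z z = 0.
Proof. by rewrite /arcdist -!expr2 => /circleE ->; exact: acos1. Qed.

Lemma arcdist_le_pi z w : circle z -> circle w -> arcdist z w <= pi.
Proof.
move=> /(circle_paramP 0)[s _ ->] /(circle_paramP s)[t st ->].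
by rewrite arcdist_param.
Qed.

Lemma arcdist_triangle z w v : circle z -> circle w -> circle v ->
  arcdist z v <= arcdist z w + arcdist w v.
Proof.
move=> /(circle_paramP 0)[s _ ->] /(circle_param_arcdist s)[t -> ->].
move=> /(circle_param_arcdist t)[u -> ->].
rewrite (le_trans (arcdist_param_le _ _))//.
by rewrite -(subrKA t s) ler_normD.
Qed.

Lemma modulusC z w : modulus (z - w) = modulus (w - z).
Proof. by congr Num.sqrt; rewrite /=; ring. Qed.

Lemma modulus_ge0 z : 0 <= modulus z. Proof. exact: sqrtr_ge0. Qed.

Lemma modulus_sqr z : modulus z ^+ 2 = z.1 ^+ 2 + z.2 ^+ 2.
Proof. by rewrite sqr_sqrtr// addr_ge0// sqr_ge0. Qed.

(** The function [sin x - x * cos x] vanishes at 0 and has derivative [x * sin x], nonnegative on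
    [[0, pi]]. *)
Lemma sin_ge_xcos (v : R) : 0 <= v <= pi -> v * cos v <= sin v.
Proof.
move=> /andP[]; rewrite le_eqVlt => /predU1P[<-|v0 vpi].
  by rewrite mul0r sin0.
pose f (x : R) := sin x - x * cos x.
have df (x : R) : is_derive x 1 f (x * sin x).
  rewrite /f; apply: is_derive_eq; rewrite /GRing.scale /=; ring.
have [|c + e] := MVT v0 (fun x _ => df x) _.
  by apply: derivable_within_continuous => x _; exact: ex_derive.
rewrite in_itv/= => /andP[c0 cv].
have : 0 <= f v - f 0.
  rewrite e subr0 !mulr_ge0 ?(ltW c0) ?(ltW v0)// sin_ge0_pi//.
  by rewrite (ltW c0) (ltW (lt_le_trans cv vpi)).
by rewrite /f sin0 mul0r !subr0 subr_ge0.
Qed.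

Lemma half_mulr2n (x : R) : x / 2 *+ 2 = x.
Proof. by rewrite -mulr_natr divfK. Qed.

Lemma modulus_arcdist z w : circle z -> circle w ->
  modulus (z - w) = 2 * sin (arcdist z w / 2).
Proof.
move=> cz; have := cz => /(circle_paramP 0)[s _ ez] cw.
have [t ew st] := circle_param_arcdist s cw.
set r := arcdist z w.
have r0 : 0 <= r by exact: arcdist_ge0.
have rpi : r <= pi by exact: arcdist_le_pi.
have rr : 0 <= r / 2 <= pi.
  have := pi_gt0 R; lra.
have s0 := sin_ge0_pi rr.
rewrite -[RHS]ger0_norm ?mulr_ge0// -sqrtr_sqr; congr Num.sqrt.
have cr : cos r = cos (s - t).
  by rewrite /r ez st cos_norm.
have := cos_mulr2n (r / 2); rewrite half_mulr2n cr cosB => h.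
rewrite exprMn sin2cos2 ez ew /=.
have := cos2Dsin2 s; have := cos2Dsin2 t; nra.
Qed.

(** With [r] the arc distance, the chord is [2 * sin (r / 2) = 4 * sin (r / 4) * cos (r / 4)], at
    least [r * cos (r / 4) ^+ 2] by [sin_ge_xcos], and [2 * cos (r / 4) ^+ 2 = 1 + cos (r / 2)] is
    at least 1. The sharp constant would be [pi / 2]. *)
Lemma arcdist_le_modulus z w : circle z -> circle w ->
  arcdist z w <= 2 * modulus (z - w).
Proof.
move=> cz cw; rewrite modulus_arcdist//.
have r0 := arcdist_ge0 cz cw; have rpi := arcdist_le_pi cz cw.
set r := arcdist z w in r0 rpi *.
have p0 := pi_gt0 R.
have h1 : r / 2 / 2 * cos (r / 2 / 2) <= sin (r / 2 / 2).
  by apply: sin_ge_xcos; lra.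
have h2 : 0 <= cos (r / 2 / 2) by apply: cos_ge0_pihalf; lra.
have h3 : 0 <= cos (r / 2) by apply: cos_ge0_pihalf; lra.
have e1 : sin (r / 2) = 2 * (cos (r / 2 / 2) * sin (r / 2 / 2)).
  by rewrite mulr_natl -sin_mulr2n half_mulr2n.
have e2 : cos (r / 2) = cos (r / 2 / 2) ^+ 2 * 2 - 1.
  by rewrite mulr_natr -cos_mulr2n half_mulr2n.
rewrite e1; set c := cos (r / 2 / 2) in h1 h2 e2 *.
set q := sin _ in h1 *.
have : r / 2 / 2 * c * c <= q * c by rewrite ler_wpM2r.
nra.
Qed.

Lemma dot_le_modulus z w : z.1 * w.1 + z.2 * w.2 <= modulus z * modulus w.
Proof.
apply: le_trans (ler_norm _) _.
rewrite -[leRHS]ger0_norm ?mulr_ge0 ?modulus_ge0// -ler_sqr ?nnegrE ?normr_ge0//.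
rewrite !real_normK ?num_real// exprMn !modulus_sqr.
have := sqr_ge0 (z.1 * w.2 - z.2 * w.1); nra.
Qed.

Lemma ler_modulusD z w : modulus (z + w) <= modulus z + modulus w.
Proof.
rewrite -ler_sqr ?nnegrE ?addr_ge0 ?modulus_ge0//.
rewrite sqrrD !modulus_sqr /=; have := dot_le_modulus z w; nra.
Qed.

Lemma modulus_sub_gt0 z w : circle z -> modulus w < 1 -> 0 < modulus (z - w).
Proof.
move=> z1 w1; have := ler_modulusD (z - w) w.
by rewrite subrK (z1 : modulus z = 1); lra.
Qed.

End geometry.

(** * Borel sets of the plane *)

Section borel.
Context {R : realType}.
Implicit Types (z w : R * R).

(** By separability: [U] is the union of the squares with rational centre and radius [1 / (n + 1)]
    that it contains, so the product sigma-algebra contains the open sets. *)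
Lemma open_measurable_prod (U : set (R * R)) : open U -> measurable U.
Proof.
move=> oU.
pose box (i : rat * rat * nat) : set (R * R) :=
  ball (ratr i.1.1 : R) i.2.+1%:R^-1 `*` ball (ratr i.1.2 : R) i.2.+1%:R^-1.
have -> : U = \bigcup_i (if `[< box i `<=` U >] then box i else set0).
  apply/seteqP; split => [z Uz|z [i _]]; last first.
    by case: asboolP => // /[apply].
  have /nbhs_ballP[e /= e0 eU] := open_nbhs_nbhs (conj oU Uz).
  have [n ne] : exists n, n.+1%:R^-1 < e / 2.
    have e20 : 0 < e / 2 by rewrite divr_gt0.
    have [n] := ltr_add_invr e20.
    by rewrite add0r => ?; exists n.
  have ne2 : n.+1%:R^-1 + n.+1%:R^-1 <= e.
    by rewrite (splitr e) lerD// ltW.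
  have ratball (x : R) : exists q : rat, ball x n.+1%:R^-1 (ratr q : R).
    have := @dense_rat R (ball x n.+1%:R^-1).
    case; [by exists x; exact: ballxx|exact: ball_open|].
    by move=> y [xy [q _ qy]]; exists q; rewrite qy.
  have [p pz] := ratball z.1; have [q qz] := ratball z.2.
  exists (p, q, n) => //; case: asboolP => [_|].
    by split; apply: ball_sym.
  case => w [/= w1 w2]; apply: eU; split => /=.
    apply: (@le_ball _ _ _ (n.+1%:R^-1 + n.+1%:R^-1)) => //.
    exact: ball_triangle pz w1.
  apply: (@le_ball _ _ _ (n.+1%:R^-1 + n.+1%:R^-1)) => //.
  exact: ball_triangle qz w2.
apply: countable_bigcupT_measurable; first exact: countableP.
move=> i; case: asboolP => // _.
by apply: measurableX; apply: open_measurable; exact: ball_open.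
Qed.

Lemma closed_measurable_prod (F : set (R * R)) : closed F -> measurable F.
Proof.
by move=> /closed_openC/open_measurable_prod/measurableC; rewrite setCK.
Qed.

Lemma continuous_modulus : continuous (@modulus R).
Proof.
move=> z; apply: (@continuous_comp _ _ _ (fun z => z.1 ^+ 2 + z.2 ^+ 2)).
  have h1 : fst @ z --> z.1 by exact: cvg_fst.
  have h2 : snd @ z --> z.2 by exact: cvg_snd.
  rewrite /prop_for /continuous_at; under eq_fun do rewrite !expr2.
  by rewrite !expr2; apply: cvgD; exact: cvgM.
exact: sqrt_continuous.
Qed.

Lemma continuous_modulus_sub z : continuous (fun w => modulus (w - z)).
Proof.
move=> w; apply: (@continuous_comp _ _ _ (fun w => w - z)); last exact: continuous_modulus.
by apply: cvgB; [exact: cvg_id|exact: cvg_cst].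
Qed.

Definition euclidean_ball z (e : R) : set (R * R) := [set w | modulus (w - z) < e].

Lemma open_euclidean_ball z e : open (euclidean_ball z e).
Proof.
rewrite /euclidean_ball -[X in open X]/((fun w => modulus (w - z)) @^-1` [set x | x < e]).
apply: open_comp; last exact: open_lt.
by move=> w _; exact: continuous_modulus_sub.
Qed.

Lemma closed_circle : closed (@circle R).
Proof.
apply: (@preimage_closed _ _ (@modulus R) [set 1]).
  by move=> z _; exact: continuous_modulus.
exact: closed_eq.
Qed.

Lemma measurable_circle : measurable (@circle R).
Proof. exact: (closed_measurable_prod closed_circle). Qed.

Lemma continuous_measurable_fun_prod (f : R * R -> R) :
  continuous f -> measurable_fun [set: R * R] f.
Proof.
move=> /continuousP cf; apply: (measurability _ (RGenOpens.measurableE R)).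
move=> _ [_ [a [b ->] <-]]; rewrite setTI; apply: open_measurable_prod.
exact/cf/interval_open.
Qed.

Lemma measurable_modulus_sub z : measurable_fun [set: R * R] (fun w => modulus (w - z)).
Proof. exact: (continuous_measurable_fun_prod (@continuous_modulus_sub z)). Qed.

(** Each strict superlevel set is the trace of an open set: a chord of length [m] changes [g] by at
    most [2 * L * m], so [g] stays above [y] on the ball of radius [(g w - y) / (2 * L + 1)] around
    [w]. The [+ 1] covers [L = 0]. *)
Lemma lipschitz_measurable_fun (L : R) (g : R * R -> R) : 0 <= L ->
  (forall z w, circle z -> circle w -> `|g z - g w| <= L * arcdist z w) ->
  measurable_fun circle g.
Proof.
move=> L0 gL; apply: (measurability _ (RGenOInfty.measurableE R)).
move=> _ [_ [y ->] <-].
have L20 : 0 < 2 * L + 1 by lra.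
have -> : circle `&` g @^-1` `]y, +oo[%classic =
    circle `&` \bigcup_(w in [set w | circle w /\ y < g w])
      euclidean_ball w ((g w - y) / (2 * L + 1)).
  apply/seteqP; split => [w [cw]|w [cw [v /= [cv yv]]]]; rewrite /= ?in_itv/= ?andbT.
    move=> yw; split => //; exists w => //=.
    by rewrite /euclidean_ball/= subrr /modulus expr0n/= addr0 sqrtr0 divr_gt0// subr_gt0.
  rewrite /euclidean_ball/= => h; split => //.
  have := gL _ _ cw cv; have := arcdist_le_modulus cw cv.
  have := modulus_ge0 (w - v); have := arcdist_ge0 cw cv.
  move: h; rewrite ltr_pdivlMr//.
  set m := modulus _; set d := arcdist _ _ => h1 d0 m0 h2.
  by rewrite ler_norml => /andP[h3 _]; nra.
apply: measurableI; first exact: measurable_circle.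
by apply: open_measurable_prod; apply: bigcup_open => w _; exact: open_euclidean_ball.
Qed.

End borel.

(** * The distance to E and the components of its complement *)

Section distance.
Context {R : realType}.
Implicit Types (z w e : R * R) (s t : R).
Local Notation param := (@circle_param R).

Lemma continuous_circle_param : continuous param.
Proof.
move=> t; exact: (cvg_pair (@continuous_cos R t) (@continuous_sin R t)).
Qed.

Lemma circle_param_neq s t : s < t < s + pi *+ 2 -> param s <> param t.
Proof.
move=> st [cst sst].
have p0 := pi_gt0 R.
have h : cos (t - s) = 1.
  by rewrite cosB cst sst -!expr2 cos2Dsin2.
have h0 : 0 < (t - s) / 2 < pi by rewrite mulr2n in st; lra.
have := sin_gt0_pi h0.
have -> : sin ((t - s) / 2) = 0; last by rewrite ltxx.
apply/eqP; rewrite -sqrf_eq0 sin2cos2.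
have := cos_mulr2n ((t - s) / 2); rewrite half_mulr2n h => e1; apply/eqP; lra.
Qed.

Lemma closed_last_le (A : set R) (s a0 : R) : closed A -> A a0 -> a0 <= s ->
  exists a, [/\ A a, a0 <= a <= s & forall x, A x -> x <= s -> x <= a].
Proof.
move=> cA Aa0 a0s.
pose B := A `&` [set x | x <= s].
have B0 : B a0 by [].
have uB : has_ubound B by exists s => x [].
have cB : closed B by apply: closedI => //; exact: closed_le.
have [Aa as_] : B (sup B).
  rewrite [X in X (sup B)](iffLR (closure_id B))//; apply: closure_sup => //.
  by exists a0.
exists (sup B); split => //; first by rewrite as_ andbT; exact: ub_le_sup.
by move=> x Ax xs; apply: ub_le_sup.
Qed.

Lemma closed_first_ge (A : set R) (s b0 : R) : closed A -> A b0 -> s <= b0 ->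
  exists b, [/\ A b, s <= b <= b0 & forall x, A x -> s <= x -> b <= x].
Proof.
move=> cA Ab0 sb0.
have cA' : closed ((fun x : R => - x) @^-1` A).
  by apply: preimage_closed => // x _; exact: opp_continuous.
have [||a [Aa /andP[a1 a2] h]] := closed_last_le (s := - s) (a0 := - b0) cA'.
- by rewrite /= opprK.
- by rewrite lerN2.
exists (- a); split => //; first by apply/andP; split; lra.
by move=> x Ax sx; rewrite lerNl; apply: h; rewrite /= ?opprK// lerN2.
Qed.

Variable E : set (R * R).
Hypotheses (E0 : E !=set0) (Ecircle : E `<=` circle) (Eclosed : closed E).

Lemma le_dist z c : (forall e, E e -> c <= arcdist z e) -> c <= dist z E.
Proof.
move=> h; apply: lb_le_inf.
  by have [e Ee] := E0; exists (arcdist z e), e.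
by move=> _ [e Ee <-]; exact: h.
Qed.

Lemma dist_le z e : circle z -> E e -> dist z E <= arcdist z e.
Proof.
move=> cz Ee; apply: ge_inf; last by exists e.
by exists 0 => _ [w Ew <-]; apply: arcdist_ge0 => //; exact: Ecircle.
Qed.

Lemma dist_ge0 z : circle z -> 0 <= dist z E.
Proof.
by move=> cz; apply: le_dist => e Ee; apply: arcdist_ge0 => //; exact: Ecircle.
Qed.

Lemma dist_le_add z w : circle z -> circle w ->
  dist z E <= dist w E + arcdist z w.
Proof.
move=> cz cw; rewrite -lerBlDr; apply: le_dist => e Ee.
rewrite lerBlDl (le_trans (dist_le cz Ee))//.
by apply: arcdist_triangle => //; exact: Ecircle.
Qed.

Lemma dist_lipschitz z w : circle z -> circle w ->
  `|dist z E - dist w E| <= arcdist z w.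
Proof.
move=> cz cw; rewrite ler_norml.
have := dist_le_add cz cw; have := dist_le_add cw cz.
by rewrite (arcdistC w z); lra.
Qed.

Lemma dist_mem z : E z -> dist z E = 0.
Proof.
move=> Ez; have cz := Ecircle Ez.
by apply/eqP; rewrite eq_le dist_ge0// andbT -(arcdistxx cz) dist_le.
Qed.

Lemma dist_eq0 z : circle z -> dist z E = 0 -> E z.
Proof.
move=> cz dz; apply: contrapT => nEz.
have [s _ zs] := circle_paramP 0 cz.
have cA : closed (param @^-1` E).
  by apply: preimage_closed => // x _; exact: continuous_circle_param.
have : nbhs s (~` (param @^-1` E)).
  apply: open_nbhs_nbhs; split; first exact: closed_openC.
  by rewrite /= -zs.
move=> /nbhs_ballP[r /= r0 rE].
have : r <= dist z E.
  apply: le_dist => e Ee.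
  have [t et] := circle_param_arcdist s (Ecircle Ee).
  rewrite -zs => ->; rewrite leNgt; apply/negP => st.
  by apply: (rE t st); rewrite /= -et.
by rewrite dz leNgt r0.
Qed.

(** The end points are the last parameter of [E] before that of [z] and the first one after it;
    [b = a + pi *+ 2] occurs when [E] is a single point. The open arc is connected, and it fills the
    component because it is relatively open and relatively closed there. *)
Lemma arc_component_param z : (circle `\` E) z ->
  exists a b, [/\ E (param a) /\ E (param b), a < b, b <= a + pi *+ 2,
    (forall t, a < t < b -> ~ E (param t)) &
    arc_component z E = param @` `]a, b[].
Proof.
move=> [cz nEz].
have [s _ zs] := circle_paramP 0 cz.
have cA : closed (param @^-1` E).
  by apply: preimage_closed => // x _; exact: continuous_circle_param.
have p0 := pi_gt0 R.
have [e Ee] := E0.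
have [t te ste] := circle_paramP s (Ecircle Ee).
have [a0 [Aa0 a0s sa0]] : exists a0, [/\ E (param a0), a0 <= s & s <= a0 + pi *+ 2].
  have [ts|st] := leP t s.
    exists t; rewrite -ste; split => //; move: te; rewrite ler_norml mulr2n; lra.
  exists (t - pi *+ 2); rewrite circle_paramBpi2 -ste subrK; split => //.
    by move: te; rewrite ler_norml mulr2n; lra.
  exact: ltW.
have [a [Aa /andP[a0a as_] amax]] := closed_last_le cA Aa0 a0s.
have Aa2 : E (param (a + pi *+ 2)) by rewrite circle_paramDpi2.
have sa2 : s <= a + pi *+ 2 by rewrite (le_trans sa0)// lerD2r.
have [b [Ab /andP[sb ba2] bmin]] := closed_first_ge cA Aa2 sa2.
have {}as_ : a < s.
  by rewrite lt_neqAle as_ andbT; apply/eqP => h; apply: nEz; rewrite zs -h.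
have {}sb : s < b.
  by rewrite lt_neqAle sb andbT; apply/eqP => h; apply: nEz; rewrite zs h.
have ab : a < b by exact: lt_trans sb.
have nE u : a < u < b -> ~ E (param u).
  move=> /andP[au ub] Eu; have [us|su] := leP u s.
    by have := amax _ Eu us; rewrite leNgt au.
  by have := bmin _ Eu (ltW su); rewrite leNgt ub.
exists a, b; split => //.
have imc (x y : R) : closed (param @` `[x, y]).
  apply: compact_closed; first exact: norm_hausdorff.
  apply: continuous_compact; last exact: segment_compact.
  exact: (continuous_subspaceT continuous_circle_param).
apply/seteqP; split; last first.
  apply: connected_component_max.
  - by exists s => //=; rewrite in_itv/= as_.
  - move=> w [u /= uab <-]; split; first exact: circle_circle_param.
    by apply: nE; move: uab; rewrite in_itv.
  - apply: connected_continuous_connected; last first.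
      exact: (continuous_subspaceT continuous_circle_param).
    exact/connected_intervalP/interval_is_interval.
have Isub := @connected_component_sub _ (circle `\` E) z.
pose B := arc_component z E `&` param @` `]a, b[.
suff -> : arc_component z E = B by exact: subIsetr.
apply/esym; apply: (@component_connected _ (circle `\` E) z).
- exists z; split; first by apply: connected_component_refl.
  by exists s => //=; rewrite in_itv/= as_.
(* Relatively open: the rest of the circle is the compact arc with parameters from [b] to
   [a + pi *+ 2]. *)
- exists (~` (param @` `[b, a + pi *+ 2])); first exact/closed_openC/imc.
  rewrite /B; apply/seteqP; split => w [Iw].
    move=> [u /=]; rewrite in_itv/= => /andP[au ub] uw; split => // -[v /=].
    rewrite in_itv/= => /andP[bv va] vw.
    have : param u <> param v.
      by apply: circle_param_neq; rewrite (lt_le_trans ub)//= (le_lt_trans va)// ltrD2r.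
    by rewrite uw vw.
  move=> nw; split => //.
  have [cw nEw] := Isub _ Iw.
  have [v av wv] := circle_paramP (a + pi) cw.
  have [va va2] : a <= v /\ v <= a + pi *+ 2.
    by move: av; rewrite ler_norml mulr2n; lra.
  exists v => //=; rewrite in_itv/=; apply/andP; split.
    by rewrite lt_neqAle va andbT; apply/eqP => h; apply: nEw; rewrite wv -h.
  rewrite ltNge; apply/negP => bv; apply: nw; exists v => //=.
  by rewrite in_itv/= bv.
(* Relatively closed: the end points lie in [E], so the closed arc meets the component in the open
   arc only. *)
- exists (param @` `[a, b]); first exact: imc.
  rewrite /B; apply/seteqP; split => w [Iw] [u /=]; rewrite in_itv/= => /andP[au ub] uw.
    by split => //; exists u => //=; rewrite in_itv/= (ltW au) (ltW ub).
  have [cw nEw] := Isub _ Iw.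
  split => //; exists u => //=; rewrite in_itv/=; apply/andP; split.
    by rewrite lt_neqAle au andbT; apply/eqP => h; apply: nEw; rewrite -uw -h.
  by rewrite lt_neqAle ub andbT; apply/eqP => h; apply: nEw; rewrite -uw h.
Qed.

Lemma measurable_arc_component z : (circle `\` E) z ->
  measurable (arc_component z E).
Proof.
move=> Ez; have [a [b [[Ea Eb] ab ba2 nE ->]]] := arc_component_param Ez.
have -> : param @` `]a, b[ = param @` `[a, b] `\` [set param a; param b].
  apply/seteqP; split => [_ [u /= uab <-]|_ [[u /= + <-] /not_orP[ua ub]]].
    move: uab; rewrite in_itv/= => uab; split.
      by exists u => //=; move: uab; rewrite in_itv/= => /andP[/ltW-> /ltW->].
    by case=> h; apply: (nE _ uab); rewrite h.
  rewrite in_itv/= => /andP[au bu]; exists u => //=; rewrite in_itv/=.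
  rewrite !lt_neqAle au bu !andbT; apply/andP; split; apply/eqP => h.
    by apply: ua; rewrite h.
  by apply: ub; rewrite h.
have haus : hausdorff_space (R * R)%type by exact: norm_hausdorff.
apply: measurableD; apply: closed_measurable_prod.
  apply: compact_closed => //; apply: continuous_compact.
    exact: (continuous_subspaceT continuous_circle_param).
  exact: segment_compact.
by apply: closedU; exact/accessible_closed_set1/hausdorff_accessible.
Qed.

(* [e1] and [e2] are the end points of the component. *)
Lemma arc_component_dist z : (circle `\` E) z ->
  exists e1 e2, [/\ circle e1, circle e2 & forall w, arc_component z E w ->
    arcdist w e1 <= dist w E \/ arcdist w e2 <= dist w E].
Proof.
move=> Ez; have [a [b [[Ea Eb] ab ba2 nE ->]]] := arc_component_param Ez.
exists (param a), (param b); split; [exact: circle_circle_param..|].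
move=> _ [u /= + <-]; rewrite in_itv/= => /andP[au ub].
suff : Num.min (arcdist (param u) (param a)) (arcdist (param u) (param b))
    <= dist (param u) E.
  by rewrite ge_min => /orP[]; [left|right].
apply: le_dist => e Ee.
have [v ev ->] := circle_param_arcdist u (Ecircle Ee).
have [vu|uv] := leP v u.
  have va : v <= a.
    by rewrite leNgt; apply/negP => h; apply: (nE v); rewrite -?ev// h (le_lt_trans vu).
  rewrite ge_min; apply/orP; left; rewrite (le_trans (arcdist_param_le _ _))//.
  by rewrite !ger0_norm; lra.
have bv : b <= v.
  by rewrite leNgt; apply/negP => h; apply: (nE v); rewrite -?ev// h (lt_trans au).
rewrite ge_min; apply/orP; right; rewrite (le_trans (arcdist_param_le _ _))//.
by rewrite !ler0_norm; lra.
Qed.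

End distance.

(** * Integrals of functions of a distance *)

Section integral_bounds.
Local Open Scope ereal_scope.
Context d (T : measurableType d) (R : realType).
Variable mu : {measure set T -> \bar R}.
Implicit Types (D : set T).

(* No measurability is needed: for nonnegative functions the library integral
   is a supremum over the simple functions below the integrand. *)
Lemma ge0_le_integral_nonmeasurable D (f g : T -> \bar R) :
  (forall x, D x -> 0 <= f x) -> (forall x, D x -> f x <= g x) ->
  \int[mu]_(x in D) f x <= \int[mu]_(x in D) g x.
Proof.
move=> f0 fg; rewrite !ge0_integralE//; last first.
  by move=> x Dx; exact: le_trans (f0 _ Dx) (fg _ Dx).
apply: le_ereal_sup => _ [h hf <-]; exists h => // x.
rewrite (le_trans (hf x))// !patchE; case: ifPn => // /set_mem Dx.
exact: fg.
Qed.

Lemma measurable_funV_ge0 D (f : T -> R) : (forall x, D x -> (0 <= f x)%R) ->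
  measurable_fun D f -> measurable_fun D (fun x => (f x)^-1%R).
Proof.
move=> f0 mf; apply: (eq_measurable_fun (fun x => (f x `^ (- 1))%R)).
  by move=> x /set_mem Dx; rewrite powRN powRr1// f0.
exact: (measurableT_comp (@measurable_powR R _) mf).
Qed.

Lemma measurable_fun_sqrtr D (f : T -> R) :
  measurable_fun D f -> measurable_fun D (fun x => Num.sqrt (f x)).
Proof.
move=> mf; have mf' := measurable_funrpos mf.
apply: (eq_measurable_fun (fun x => (f^\+ x `^ (2^-1))%R)); rewrite /funrpos.
  move=> x _; have [f0|f0] := leP (f x) 0%R.
    by rewrite powR0 ?invr_eq0// ler0_sqrtr.
  by rewrite powR12_sqrt// ltW.
exact: (measurableT_comp (@measurable_powR R _) mf').
Qed.

(* Layer-cake: the integrand is dominated by a series of indicators. *)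
Lemma ge0_integral_cover_le D (g : T -> R) (c r : nat -> R) (A : nat -> set T)
    (B : R) : measurable D ->
  (forall n, (0 <= c n)%R) -> (forall n, measurable (A n)) ->
  (forall n, A n `<=` D) -> (forall n, mu (A n) <= (r n)%:E) ->
  (forall n, (\sum_(0 <= i < n) c i * r i <= B)%R) ->
  (forall x, D x -> (0 <= g x)%R) ->
  (forall x, D x -> (0 < g x)%R -> exists2 n, A n x & (g x <= c n)%R) ->
  \int[mu]_(x in D) (g x)%:E <= B%:E.
Proof.
move=> mD c0 mA AD Ar cB g0 gc.
pose F n x := (c n)%:E * (\1_(A n) x)%:E : \bar R.
have F0 n x : 0 <= F n x by rewrite mule_ge0// lee_fin.
have m1 n : measurable_fun D (fun x => (\1_(A n) x)%:E : \bar R).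
  by apply/measurable_EFinP; exact: measurable_indic.
have mF n : measurable_fun D (F n) by exact: measurable_funeM.
apply: (@le_trans _ _ (\int[mu]_(x in D) \sum_(0 <= n <oo) F n x)).
  apply: ge0_le_integral_nonmeasurable => x Dx; first by rewrite lee_fin g0.
  have [gx0|gx0] := leP (g x) 0%R.
    by rewrite (@le_trans _ _ 0)// nneseries_ge0.
  have [n Anx gn] := gc _ Dx gx0.
  rewrite (@le_trans _ _ (F n x))//.
    by rewrite /F indicE mem_set// mule1 lee_fin.
  rewrite (le_trans _ (nneseries_lim_ge n.+1 _))//.
  by rewrite big_nat_recr//= leeDr// sume_ge0.
rewrite integral_nneseries//.
apply: lime_le; first by apply: is_cvg_nneseries => n _ _; exact: integral_ge0.
apply: nearW => n.
apply: (@le_trans _ _ (\sum_(0 <= i < n) (c i * r i)%:E)).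
  apply: lee_sum => i _; rewrite ge0_integralZl_EFin// integral_indic//.
  by rewrite setIidl ?EFinM// lee_pmul ?lee_fin.
by rewrite sumEFin lee_fin.
Qed.

(** When sublevel sets of [rho] have measure at most [C * t], the [n]th layer costs [C * c n * t n],
    and the geometric decay sums these costs to [2 * C * K]. This plays the role of a change of
    variables to [rho], at the price of constants. *)
Lemma ge0_integral_layer_le D (rho g : T -> R) (c t : nat -> R) (C K : R) :
  measurable D -> (0 <= C)%R -> (0 <= K)%R ->
  (forall n, (0 <= c n)%R) -> (forall n, (0 <= t n)%R) ->
  (forall n, (c n * t n <= K / 2 ^+ n)%R) ->
  (forall n, measurable (D `&` [set x | (rho x <= t n)%R])) ->
  (forall n, mu (D `&` [set x | (rho x <= t n)%R]) <= (C * t n)%:E) ->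
  (forall x, D x -> (0 <= g x)%R) ->
  (forall x, D x -> (0 < g x)%R -> exists2 n, (g x <= c n)%R & (rho x <= t n)%R) ->
  \int[mu]_(x in D) (g x)%:E <= (2 * C * K)%:E.
Proof.
move=> mD C0 K0 c0 t0 ct mrho rhoC g0 gct.
apply: (ge0_integral_cover_le mD c0 mrho _ rhoC) => //; last first.
  by move=> x Dx /(gct _ Dx)[n gn rn]; exists n.
move=> n; have h20 : (0 < 2^-1 :> R)%R by rewrite invr_gt0.
have h21 : (`|2^-1| < 1 :> R)%R by rewrite ger0_norm ?ltW// invf_lt1// ltr1n.
have := geometric_le_lim n (mulr_ge0 C0 K0) h20 h21.
rewrite /series/= (_ : 1 - 2^-1 = 2^-1 :> R)%R; last by field.
rewrite invrK => h; rewrite -[leRHS]mulrA [leRHS]mulrC; apply: le_trans h.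
apply: ler_sum => i _; rewrite exprVn mulrCA -[leRHS]mulrA.
by rewrite ler_wpM2l.
Qed.

Lemma expr4_floor (u : R) : (1 <= u)%R -> exists n, (4 ^+ n <= u < 4 ^+ n.+1)%R.
Proof.
move=> u1.
have [m um] : exists m, (u < 4 ^+ m)%R.
  exists (Num.bound u); rewrite (lt_le_trans (archi_boundP (le_trans ler01 u1)))//.
  by rewrite -natrX ler_nat ltnW// ltn_expl.
elim: m um => [|m ih] um; first by move: um; rewrite expr0 ltNge u1.
by have [/ih//|mu_] := ltP u (4 ^+ m)%R; exists m; rewrite mu_.
Qed.

Lemma sqrtr_expr4 n (x : R) : Num.sqrt (4 ^+ n * x) = (2 ^+ n * Num.sqrt x)%R.
Proof.
rewrite (_ : 4 ^+ n = (2 ^+ n) ^+ 2 :> R)%R; last first.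
  by rewrite exprAC; congr (_ ^+ n)%R; rewrite expr2 -natrM.
by rewrite sqrtrM ?sqr_ge0// sqrtr_sqr ger0_norm.
Qed.

(** Layers at the heights [x / 4 ^+ n], shrinking to 0: each costs half of the previous one, because
    the power [- 1 / 2] is integrable at 0. *)
Lemma integral_sqrtV_le D (rho : T -> R) (C x : R) : measurable D ->
  (0 <= C)%R -> (0 < x)%R ->
  measurable_fun D rho -> (forall y, D y -> (0 <= rho y <= x)%R) ->
  (forall t, (0 < t)%R -> mu (D `&` [set y | (rho y <= t)%R]) <= (C * t)%:E) ->
  \int[mu]_(y in D) ((Num.sqrt (rho y))^-1)%:E <= (4 * C * Num.sqrt x)%:E.
Proof.
move=> mD C0 x0 mrho rho0 rhoC.
have sx0 : (0 < Num.sqrt x)%R by rewrite sqrtr_gt0.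
have -> : (4 * C * Num.sqrt x = 2 * C * (2 * Num.sqrt x))%R by ring.
apply: (@ge0_integral_layer_le D rho _ (fun n => 2 ^+ n.+1 / Num.sqrt x)%R
  (fun n => x / 4 ^+ n)%R) => //.
- by move=> n; rewrite divr_ge0// ltW.
- move=> n; rewrite -[X in (_ * (X / _) <= _)%R](sqr_sqrtr (ltW x0)).
  rewrite (_ : 4 ^+ n = 2 ^+ n * 2 ^+ n :> R)%R; last by rewrite -exprMn -natrM.
  rewrite exprS le_eqVlt; apply/orP; left; apply/eqP.
  by field; rewrite !gt_eqF// exprn_gt0.
- by move=> n; apply: (measurable_fun_le mD mrho); exact: measurable_cst.
- by move=> n; apply: rhoC; rewrite divr_gt0// exprn_gt0.
(* At [rho y = 0] the integrand is [0^-1 = 0], so only points with [rho y > 0] need a layer. *)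
- move=> y Dy; rewrite invr_gt0 sqrtr_gt0 => ry0.
  have /andP[_ ryx] := rho0 _ Dy.
  have [|n /andP[n1 n2]] := @expr4_floor (x / rho y).
    by rewrite ler_pdivlMr// mul1r.
  have p4 : (0 < 4 ^+ n :> R)%R by rewrite exprn_gt0.
  exists n.
    rewrite invf_ple ?posrE ?sqrtr_gt0// ?divr_gt0// ?exprn_gt0// invf_div.
    rewrite ler_pdivrMr ?exprn_gt0// mulrC -sqrtr_expr4 ler_sqrt.
      by rewrite ltW// -ltr_pdivrMr.
    by rewrite mulr_ge0 ?exprn_ge0// ltW.
  by rewrite ler_pdivlMr// mulrC -ler_pdivlMr.
Qed.

(** Layers at the heights [4 ^+ n.+1 * x], growing to infinity: the costs halve again, because the
    power [- 3 / 2] is integrable at infinity. *)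
Lemma integral_sqrt3V_le D (rho : T -> R) (C x : R) : measurable D ->
  (0 <= C)%R -> (0 < x)%R ->
  measurable_fun D rho -> (forall y, D y -> (x <= rho y)%R) ->
  (forall t, (0 < t)%R -> mu (D `&` [set y | (rho y <= t)%R]) <= (C * t)%:E) ->
  \int[mu]_(y in D) ((rho y * Num.sqrt (rho y))^-1)%:E
    <= (8 * C / Num.sqrt x)%:E.
Proof.
move=> mD C0 x0 mrho rho0 rhoC.
have sx0 : (0 < Num.sqrt x)%R by rewrite sqrtr_gt0.
have -> : (8 * C / Num.sqrt x = 2 * C * (4 / Num.sqrt x))%R.
  by field; rewrite gt_eqF.
apply: (@ge0_integral_layer_le D rho _
  (fun n => (4 ^+ n * x * (2 ^+ n * Num.sqrt x))^-1)%R
  (fun n => 4 ^+ n.+1 * x)%R) => //.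
- by move=> n; rewrite invr_ge0 !mulr_ge0 ?exprn_ge0// ltW.
- by move=> n; rewrite mulr_ge0 ?exprn_ge0// ltW.
- move=> n; rewrite exprS le_eqVlt; apply/orP; left; apply/eqP.
  by field; rewrite !gt_eqF ?exprn_gt0.
- by move=> n; apply: (measurable_fun_le mD mrho); exact: measurable_cst.
- by move=> n; apply: rhoC; rewrite mulr_gt0// exprn_gt0.
- move=> y Dy; have r0 := lt_le_trans x0 (rho0 _ Dy).
  by rewrite invr_ge0 mulr_ge0// ltW.
- move=> y Dy _; have r0 := lt_le_trans x0 (rho0 _ Dy).
  have [|n /andP[n1 n2]] := @expr4_floor (rho y / x).
    by rewrite ler_pdivlMr// mul1r rho0.
  exists n; last by rewrite ltW// -ltr_pdivrMr.
  have h : (4 ^+ n * x <= rho y)%R by rewrite -ler_pdivlMr.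
  rewrite lef_pV2 ?posrE ?mulr_gt0 ?exprn_gt0 ?sqrtr_gt0//.
  have x0' := ltW x0.
  rewrite ler_pM// ?mulr_ge0 ?exprn_ge0//.
  by rewrite -sqrtr_expr4 ler_sqrt// ltW.
Qed.

End integral_bounds.

(** * Arc length *)

Section arclength_measure.
Context {R : realType}.
Implicit Types (z w : R * R).
Local Notation param := (@circle_param R).

Lemma arclengthE (A : set (R * R)) :
  arclength A = lebesgue_measure (param @^-1` A `&` `[0, pi *+ 2[%classic).
Proof. by []. Qed.

Lemma measurable_circle_param_preimage (A : set (R * R)) :
  measurable A -> measurable (param @^-1` A).
Proof.
move=> mA; rewrite -[X in measurable X]setTI.
exact: measurable_circle_param.
Qed.

Lemma arclength_setT : arclength [set: R * R] = (pi *+ 2)%:E.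
Proof.
rewrite arclengthE preimage_setT setTI lebesgue_measure_itv/= lte_fin.
by rewrite mulrn_wgt0 ?pi_gt0// oppr0 adde0.
Qed.

Lemma arclength_circle : arclength (@circle R) = (pi *+ 2)%:E.
Proof.
rewrite -arclength_setT !arclengthE preimage_setT (_ : param @^-1` circle = setT)//.
by apply/seteqP; split => // t _; exact: circle_circle_param.
Qed.

Lemma arcdist_lipschitz z : circle z -> forall w v, circle w -> circle v ->
  `|arcdist z w - arcdist z v| <= 1 * arcdist w v.
Proof.
move=> cz w v cw cv; rewrite mul1r ler_norml.
have := arcdist_triangle cz cw cv; have := arcdist_triangle cz cv cw.
by rewrite (arcdistC v w); lra.
Qed.

Lemma measurable_arcdist z : circle z -> measurable_fun circle (arcdist z).
Proof.
by move=> cz; exact: lipschitz_measurable_fun ler01 (arcdist_lipschitz cz).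
Qed.

Lemma measurable_arcball z (t : R) : circle z ->
  measurable (circle `&` [set w | arcdist z w <= t]).
Proof.
move=> cz; apply: (measurable_fun_le (@measurable_circle R)).
  exact: measurable_arcdist.
exact: measurable_cst.
Qed.

(** Parameters are cut at 0, so the ball can wrap around: its parameters in [[0, 2 pi[] lie in three
    intervals of length [2 * t], centred at [s] and at its two translates by a period. Hence 6. *)
Lemma arclength_arcball z (t : R) : circle z -> 0 < t ->
  (arclength (circle `&` [set w | (arcdist z w <= t)%R]) <= (6 * t)%:E)%E.
Proof.
move=> cz t0; have p0 := pi_gt0 R.
have [s] := circle_paramP pi cz.
rewrite ler_norml => /andP[s1 s2] zs.
pose I (x : R) : set R := `[x - t, x + t]%classic.
have mI x : measurable (I x) by exact: measurable_itv.
have lI x : lebesgue_measure (I x) = (2 * t)%:E.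
  rewrite lebesgue_measure_itv/= lte_fin -EFinD; case: ltP => h; last by exfalso; lra.
  by congr EFin; ring.
pose J := I s `|` I (s + pi *+ 2) `|` I (s - pi *+ 2).
have mJ : measurable J by do 2 (apply: measurableU => //).
rewrite arclengthE; apply: (@le_trans _ _ (lebesgue_measure J)).
  apply: le_measure; rewrite ?inE//.
    apply: measurableI; last exact: measurable_itv.
    by apply: measurable_circle_param_preimage; exact: measurable_arcball.
  move=> u [[_ /=]]; rewrite zs arcdist_circle_param in_itv/= => h /andP[u0 u2].
  rewrite /J /I /= !in_itv/=.
  rewrite mulr2n in u2 *.
  have [h1|h1] := leP (s - u) (- pi).
    left; right.
    move: h; rewrite -cosD2pi mulr2n acos_cos ler_norml; lra.
  have [h2|h2] := leP pi (s - u).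
    right.
    have e : s - u = s - u - pi *+ 2 + pi *+ 2 by rewrite subrK.
    move: h; rewrite e cosD2pi mulr2n acos_cos ler_norml; lra.
  left; left; move: h; rewrite acos_cos ler_norml; lra.
have lU (A B : set R) : measurable A -> measurable B ->
    (lebesgue_measure (A `|` B) <= lebesgue_measure A + lebesgue_measure B)%E.
  by move=> mA mB; exact: measureU2.
have -> : ((6 * t)%:E = (2 * t)%:E + (2 * t)%:E + (2 * t)%:E)%E.
  by rewrite -!EFinD; congr EFin; ring.
rewrite (le_trans (lU _ _ _ _))//; first exact: measurableU.
by rewrite -[X in (_ <= _ + X)%E](lI (s - pi *+ 2)) leeD2r// (le_trans (lU _ _ _ _))// !lI.
Qed.

Lemma ge0_integral_arclength (f : R * R -> \bar R) :
  measurable_fun circle f -> (forall w, circle w -> 0 <= f w)%E ->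
  (\int[arclength]_(w in circle) f w =
   \int[lebesgue_measure]_(t in `[0%R, (pi *+ 2)%R]) f (param t))%E.
Proof.
move=> mf f0.
have circleT : param @^-1` circle = setT.
  by apply/seteqP; split => // t _; exact: circle_circle_param.
have mfp : measurable_fun [set: R] (f \o param).
  move=> _ Y mY; rewrite -circleT comp_preimage -preimage_setI.
  rewrite -[X in measurable X]setTI; apply: measurable_circle_param => //.
  by apply: mf => //; exact: measurable_circle.
have fp0 t : (0 <= (f \o param) t)%E by apply: f0; exact: circle_circle_param.
pose nu := [the measure (measurableTypeR R) R of
  mrestr lebesgue_measure (@measurable_0_2pi R)].
transitivity (\int[nu]_(t in param @^-1` circle) (f \o param) t)%E.
  have mp : measurable_fun [set: measurableTypeR R] param.
    exact: measurable_circle_param.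
  apply: (ge0_integral_pushforward mp nu) => //.
  - exact: measurable_circle.
  - by move=> w /set_mem; exact: f0.
rewrite circleT.
rewrite (@ge0_negligible_integral _ _ _ nu _ (~` `[0, pi *+ 2[%classic))//; last 2 first.
- exact: measurableC.
- by rewrite /= /mrestr setICl measure0.
rewrite setTD setCK (eq_measure_integral lebesgue_measure); last first.
  by move=> A mA AD; rewrite /= /mrestr setIidl.
rewrite integral_itv_bndo_bndc//.
exact: measurable_funTS.
Qed.

End arclength_measure.

(** * The Poisson integral of a Lipschitz function *)

Section poisson_integral.
Context {R : realType}.
Implicit Types (z w : R * R) (f : R * R -> R).
Local Notation param := (@circle_param R).

Definition poisson_kernel w z : R := (1 - modulus w ^+ 2) / modulus (z - w) ^+ 2.

Lemma poisson_kernel_ge0 w z : modulus w <= 1 -> 0 <= poisson_kernel w z.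
Proof.
move=> w1; rewrite divr_ge0 ?sqr_ge0// subr_ge0 expr_le1 ?modulus_ge0//.
Qed.

Lemma measurable_poisson_kernel w : measurable_fun circle (poisson_kernel w).
Proof.
apply: measurable_funM; first exact: measurable_cst.
apply: measurable_funV_ge0; first by move=> z _; exact: sqr_ge0.
by apply: measurable_funX; apply: measurable_funTS; exact: measurable_modulus_sub.
Qed.

(* With [u = Im (conj w * e^(it))] and [v = Re (1 - conj w * e^(it))],
   the function [t + 2 atan (u / v)] is an antiderivative of the kernel. *)
Lemma integral_poisson_kernel w : modulus w < 1 ->
  (\int[arclength]_(z in circle) (poisson_kernel w z)%:E = (pi *+ 2)%:E)%E.
Proof.
move=> w1; rewrite ge0_integral_arclength; last 2 first.
- by apply/measurable_EFinP; exact: measurable_poisson_kernel.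
- by move=> z _; rewrite lee_fin poisson_kernel_ge0// ltW.
pose x := w.1; pose y := w.2.
have v_gt0 t : 0 < 1 - x * cos t - y * sin t.
  have := dot_le_modulus w (param t).
  rewrite (circle_circle_param t : modulus _ = 1) mulr1 /= -/x -/y; lra.
pose F (t : R) := t + 2 * atan ((x * sin t - y * cos t) / (1 - x * cos t - y * sin t)).
have dF (t : R) : is_derive t 1 F (poisson_kernel w (param t)).
  have v0 : 1 - x * cos t - y * sin t != 0 by rewrite gt_eqF.
  rewrite /F; apply: is_derive_eq.
  rewrite /poisson_kernel !modulus_sqr /= -/x -/y /GRing.scale/=.
  have q0 : (cos t - x) ^+ 2 + (sin t - y) ^+ 2 != 0.
    have := modulus_sub_gt0 (circle_circle_param t) w1.
    by move=> /(exprn_gt0 2); rewrite modulus_sqr /= => /lt0r_neq0.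
  have cs := cos2Dsin2 t.
  set u := x * sin t - y * cos t; set v := 1 - x * cos t - y * sin t in v0 *.
  have qE : (cos t - x) ^+ 2 + (sin t - y) ^+ 2 = u ^+ 2 + v ^+ 2.
    transitivity (u ^+ 2 + v ^+ 2 + (1 - (x ^+ 2 + y ^+ 2)) * (cos t ^+ 2 + sin t ^+ 2 - 1)).
      by rewrite /u /v; ring.
    by rewrite cs subrr mulr0 addr0.
  have xyE : x ^+ 2 + y ^+ 2 = u ^+ 2 + (1 - v) ^+ 2.
    transitivity ((x ^+ 2 + y ^+ 2) * (cos t ^+ 2 + sin t ^+ 2)).
      by rewrite cs mulr1.
    by rewrite /u /v; ring.
  rewrite qE in q0 *; rewrite xyE.
  have -> : (0 + 1) * - (x * - sin t) - y * cos t = u by rewrite /u; ring.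
  have -> : x * cos t - y * - sin t = 1 - v by rewrite /v; ring.
  by field; rewrite q0 v0.
rewrite (@continuous_FTC2 _ (fun t => poisson_kernel w (param t)) F); first last.
- by move=> t _; rewrite derive1E; exact: derive_val.
- split => [t _||]; first exact: ex_derive.
    by apply: cvg_at_right_filter; apply: differentiable_continuous; apply/derivable1_diffP.
  by apply: cvg_at_left_filter; apply: differentiable_continuous; apply/derivable1_diffP.
- apply: continuous_subspaceT => t; rewrite /poisson_kernel.
  have ct : (fun t => modulus (param t - w)) @ t --> modulus (param t - w).
    apply: (@continuous_comp _ _ _ param (fun z => modulus (z - w))).
      exact: continuous_circle_param.
    exact: continuous_modulus_sub.
  have c2 : (fun t => modulus (param t - w) ^+ 2) @ t --> modulus (param t - w) ^+ 2.
    by rewrite expr2; under eq_fun do rewrite expr2; exact: cvgM.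
  apply: cvgM; first exact: cvg_cst.
  apply: cvgV => //; rewrite expf_neq0// gt_eqF//.
  exact: modulus_sub_gt0 (circle_circle_param t) w1.
- by rewrite mulrn_wgt0 ?pi_gt0.
by rewrite /F sin2pi cos2pi sin0 cos0 -EFinB; congr EFin; ring.
Qed.

Lemma integrable_poisson_kernel w : modulus w < 1 ->
  arclength.-integrable circle (EFin \o poisson_kernel w).
Proof.
move=> w1; apply/integrableP; split.
  by apply/measurable_EFinP; exact: measurable_poisson_kernel.
under eq_integral.
  move=> z _ /=; rewrite ger0_norm ?poisson_kernel_ge0 ?ltW//; over.
by rewrite integral_poisson_kernel// ltry.
Qed.

Lemma Rintegral_poisson_kernel w : modulus w < 1 ->
  \int[arclength]_(z in circle) poisson_kernel w z = pi *+ 2.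
Proof. by move=> w1; rewrite /Rintegral integral_poisson_kernel. Qed.

(** * Boundary values of Lipschitz functions *)

Section lipschitz.
Variables (L : R) (f : R * R -> R).
Hypothesis L0 : 0 <= L.
Hypothesis fL : forall z w, circle z -> circle w -> `|f z - f w| <= L * arcdist z w.

Lemma integrable_poisson_kernelM w : modulus w < 1 ->
  arclength.-integrable circle (EFin \o (fun z => poisson_kernel w z * f z)).
Proof.
move=> w1.
pose z0 := param 0; have cz0 : circle z0 by exact: circle_circle_param.
pose M := `|f z0| + L * pi.
have M0 : 0 <= M by rewrite addr_ge0// mulr_ge0// pi_ge0.
apply: (@le_integrable _ _ _ _ _ _ _ (EFin \o (fun z => M * poisson_kernel w z))).
- exact: measurable_circle.
- apply/measurable_EFinP; apply: measurable_funM; first exact: measurable_poisson_kernel.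
  exact: lipschitz_measurable_fun L0 fL.
- move=> z cz /=; rewrite lee_fin normrM [leRHS]normrM mulrC ler_wpM2r//.
  rewrite [leRHS]ger0_norm// -[f z](subrK (f z0)) (le_trans (ler_normD _ _))//.
  rewrite addrC lerD2l (le_trans (fL cz cz0))// ler_wpM2l//.
  exact: arcdist_le_pi.
- have -> : EFin \o (fun z => M * poisson_kernel w z) =
    (fun z => M%:E * (EFin \o poisson_kernel w) z)%E by [].
  apply: integrableZl; first exact: measurable_circle.
  exact: integrable_poisson_kernel.
Qed.

(* The integrand is bounded by [poisson_kernel w v * |f v - f z|], where
   [|v - w| <= e + |v - w| ^+ 2 / e] and [|v - w| ^+ 2] cancels the
   denominator of the kernel. *)
Lemma poisson_sub_le z w e : circle z -> modulus w < 1 -> 0 < e ->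
  `|poisson f w - f z| <=
    2 * L * (modulus (w - z) + e + (1 - modulus w ^+ 2) / e).
Proof.
move=> cz w1 e0.
have p0 : 0 < pi *+ 2 :> R by rewrite mulrn_wgt0// pi_gt0.
have mc := @measurable_circle R.
have iP := integrable_poisson_kernel w1.
have iPf := integrable_poisson_kernelM w1.
pose g v := poisson_kernel w v * (f v - f z).
have iPz : arclength.-integrable circle (EFin \o (fun v => f z * poisson_kernel w v)).
  rewrite (_ : EFin \o _ = (fun v => (f z)%:E * (EFin \o poisson_kernel w) v)%E)//.
  exact: integrableZl.
have ig : arclength.-integrable circle (EFin \o g).
  rewrite (_ : EFin \o g = (EFin \o (fun v => (poisson_kernel w v * f v)%R)) \-
    (EFin \o (fun v => (f z * poisson_kernel w v)%R)))%E.
    exact: integrableB.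
  by apply/funext => v; rewrite /g /= -EFinB; congr EFin; ring.
have -> : poisson f w - f z = (pi *+ 2)^-1 * \int[arclength]_(v in circle) g v.
  rewrite /poisson -/(poisson_kernel _ _) /g.
  under [in RHS]eq_Rintegral do rewrite mulrBr [_ * f z]mulrC.
  rewrite RintegralB// RintegralZl// Rintegral_poisson_kernel// mulrBr.
  by congr (_ - _); rewrite mulrCA mulVf ?mulr1// gt_eqF.
rewrite normrM ger0_norm ?invr_ge0 ?(ltW p0)// ler_pdivrMl//.
rewrite (le_trans (le_normr_Rintegral _ _))//.
pose A := 2 * L * (modulus (w - z) + e).
pose B := 2 * L * ((1 - modulus w ^+ 2) / e).
have iB : arclength.-integrable circle (EFin \o cst B : R * R -> \bar R).
  apply/integrableP; split; first by apply/measurable_EFinP; exact: measurable_cst.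
  rewrite [X in (X < _)%E](integral_cst _ mc `|B|%:E).
  by rewrite [X in (_ * X)%E]arclength_circle -EFinM ltry.
have iA : arclength.-integrable circle (EFin \o (fun v => A * poisson_kernel w v)).
  rewrite (_ : EFin \o _ = (fun v => A%:E * (EFin \o poisson_kernel w) v)%E)//.
  exact: integrableZl.
apply: (@le_trans _ _ (\int[arclength]_(v in circle) (A * poisson_kernel w v + B))).
  apply: le_Rintegral => //.
  - exact: integrable_norm.
  - rewrite (_ : EFin \o _ = (EFin \o (fun v => (A * poisson_kernel w v)%R))
      \+ (EFin \o cst B))%E//.
    exact: integrableD.
  move=> v cv; rewrite /g normrM ger0_norm ?poisson_kernel_ge0 ?(ltW w1)//.
  have vw0 := modulus_sub_gt0 cv w1.
  have P0 := poisson_kernel_ge0 v (ltW w1).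
  have Pm : poisson_kernel w v * modulus (v - w) ^+ 2 = 1 - modulus w ^+ 2.
    by rewrite /poisson_kernel divfK// expf_neq0// gt_eqF.
  have h1 := fL cv cz.
  have h2 := arcdist_le_modulus cv cz.
  have h3 : modulus (v - z) <= modulus (v - w) + modulus (w - z).
    by rewrite -[v - z](subrKA w) ler_modulusD.
  have h4 : modulus (v - w) <= e + modulus (v - w) ^+ 2 / e.
    rewrite -lerBlDl ler_pdivlMr//.
    have := sqr_ge0 (modulus (v - w) - e); have := modulus_ge0 (v - w); nra.
  have h5 : `|f v - f z| <= 2 * L * (modulus (w - z) + e + modulus (v - w) ^+ 2 / e).
    rewrite (le_trans h1)// (mulrC 2) -mulrA ler_wpM2l//; lra.
  rewrite (le_trans (ler_wpM2l P0 h5))// /A /B -Pm le_eqVlt; apply/orP; left.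
  by apply/eqP; ring.
rewrite RintegralD// RintegralZl// Rintegral_poisson_kernel// Rintegral_cst//.
rewrite [X in _ + _ * fine X <= _]arclength_circle /= /A /B le_eqVlt.
apply/orP; left.
by apply/eqP; ring.
Qed.

Lemma nt_cvg_lipschitz z : circle z -> nt_cvg f z (f z).
Proof.
move=> cz a a1; apply/cvgrPdist_le => e e0.
have L1 : 0 < 2 * L + 1 by have := L0; lra.
pose d := e / (2 * L + 1) / 3.
have d0 : 0 < d by rewrite !divr_gt0.
(* The bound [d] controls [|w - z|]; the bound [d ^+ 2 / 2] controls [(1 - |w| ^+ 2) / d], since
   [1 - |w| ^+ 2 <= 2 * |w - z|]. Then each of the three terms of [poisson_sub_le] is at most
   [d]. *)
have ez : nbhs z [set w | modulus (w - z) < Num.min d (d ^+ 2 / 2)].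
  apply: open_nbhs_nbhs; split; first exact: open_euclidean_ball.
  by rewrite /= subrr /modulus/= expr0n/= addr0 sqrtr0 lt_min d0 divr_gt0 ?exprn_gt0.
near=> w.
have [w1 _] : stolz a z w by near: w; exact: withinT.
have : modulus (w - z) < Num.min d (d ^+ 2 / 2).
  by near: w; exact: cvg_within.
rewrite lt_min => /andP[wz1 wz2].
rewrite distrC (le_trans (poisson_sub_le cz w1 d0))//.
have h1 : (1 - modulus w ^+ 2) / d <= d.
  rewrite ler_pdivrMr//.
  have : modulus z <= modulus (w - z) + modulus w.
    by rewrite modulusC -[X in modulus X <= _](subrK w) ler_modulusD.
  rewrite (cz : modulus z = 1); have := modulus_ge0 w; nra.
have -> : e = (2 * L + 1) * (3 * d).
  by rewrite /d; field; rewrite gt_eqF.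
apply: ler_pM; [by rewrite mulr_ge0| |by rewrite lerDl|lra].
have h0 : 0 <= (1 - modulus w ^+ 2) / d.
  rewrite divr_ge0 ?(ltW d0)// subr_ge0 expr_le1 ?modulus_ge0//; exact: ltW.
have := modulus_ge0 (w - z); lra.
Unshelve. all: by end_near. Qed.

Lemma nt_lim_lipschitz z : circle z -> nt_lim f z = f z.
Proof.
move=> cz; rewrite /nt_lim; apply: xget_unique => [|l lcvg].
  exact: nt_cvg_lipschitz.
have st a1 := nt_cvg_lipschitz cz a1.
have two1 : 1 < 2 :> R by rewrite ltr1n.
(* Limits are unique only if the Stolz region accumulates at [z]; the radial points [(1 - r) * z]
   show that it does. *)
have PF : ProperFilter (within (stolz 2 z) (nbhs z)).
  apply: within_nbhs_proper; rewrite /infer => U /nbhs_ballP[e /= e0 eU].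
  pose r := Num.min e 1 / 2.
  have r0 : 0 < r by rewrite divr_gt0 ?lt_min ?e0 ?ltr01.
  have r12 : r <= 2^-1 by rewrite /r ler_pdivrMr// mulVf// ge_min lexx orbT.
  have re : r < e.
    have : Num.min e 1 <= e by rewrite ge_min lexx.
    by rewrite /r ltr_pdivrMr//; lra.
  have mZ (c : R) : 0 <= c -> modulus (c * z.1, c * z.2) = c.
    move=> c0; rewrite /modulus/= !exprMn -mulrDr (iffLR (circleE z) cz) mulr1.
    by rewrite sqrtr_sqr ger0_norm.
  have coord (x : R) : x ^+ 2 <= 1 -> ball x e ((1 - r) * x).
    move=> x1; rewrite /ball/=.
    have -> : x - (1 - r) * x = r * x by ring.
    have {}x1 : `|x| <= 1.
      by rewrite -(@expr_le1 _ 2)// real_normK// num_real.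
    rewrite normrM (gtr0_norm r0) (le_lt_trans _ re)// ler_piMr// ltW//.
  have z1 := iffLR (circleE z) cz.
  exists ((1 - r) * z.1, (1 - r) * z.2); split.
    rewrite /stolz/= mZ; last lra.
    split; first lra.
    have -> : ((1 - r) * z.1, (1 - r) * z.2) - z = - (r * z.1, r * z.2).
      by rewrite [z in _ - z]surjective_pairing; congr pair; rewrite /=; ring.
    have -> (v : R * R) : modulus (- v) = modulus v by rewrite /modulus/= !sqrrN.
    by rewrite mZ ?ltW//; lra.
  apply: eU; split; apply: coord; rewrite -z1 ?lerDl ?lerDr sqr_ge0//.
exact: (cvg_unique _ (lcvg _ two1) (st _ two1)).
Qed.

Lemma local_dirichlet_lipschitz z : circle z -> (local_dirichlet f z =
  ((pi *+ 2)^-1)%R%:E * \int[arclength]_(w in circle)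
    (`|f w - f z| ^+ 2 / modulus (w - z) ^+ 2)%R%:E)%E.
Proof.
move=> cz; rewrite /local_dirichlet asboolT; last first.
  by exists (f z); exact: nt_cvg_lipschitz.
congr (_ * _)%E; apply: eq_integral => w /set_mem cw.
by rewrite !nt_lim_lipschitz.
Qed.

End lipschitz.
End poisson_integral.

(** * Functions of the distance to E *)

Section profile.
Context {R : realType}.
Implicit Types (a : nat -> R) (x y r u v : R).

Lemma ln_le_sub1 u : 0 < u -> ln u <= u - 1.
Proof.
move=> u0; have := @le_ln1Dx R (u - 1).
have -> : 1 + (u - 1) = u by ring.
by apply; lra.
Qed.

(** Height 3 and slope -1 make [4 - ramp u] the clamp of [u] to [[1, 4]]. Over the scales [4 ^+ n]
    these clamps tile the half-line, so their logarithms telescope. *)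
Definition ramp u : R := Num.min 3 (Num.max 0 (4 - u)).

Lemma ramp_ge0 u : 0 <= ramp u.
Proof. by rewrite le_min ler0n le_max lexx. Qed.

Lemma ramp_le3 u : ramp u <= 3.
Proof. by rewrite ge_min lexx. Qed.

Lemma ramp_eq3 u : u <= 1 -> ramp u = 3.
Proof. by move=> u1; rewrite /ramp max_r ?min_l//; lra. Qed.

Lemma ramp_eq0 u : 4 <= u -> ramp u = 0.
Proof. by move=> u1; rewrite /ramp max_l ?min_r//; lra. Qed.

Lemma rampP u : [\/ u <= 1 /\ ramp u = 3, 1 <= u <= 4 /\ ramp u = 4 - u
  | 4 <= u /\ ramp u = 0].
Proof.
have [u1|u1] := leP u 1; first by constructor 1; rewrite ramp_eq3.
have [u4|u4] := leP 4 u; first by constructor 3; rewrite ramp_eq0.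
by constructor 2; rewrite /ramp max_r ?min_r; lra.
Qed.

Lemma ramp_decr u v : u <= v -> ramp v <= ramp u.
Proof.
by move=> uv; have [] := rampP u; have [] := rampP v; move=> [? ->] [? ->]; lra.
Qed.

Lemma ramp_lipschitz u v : `|ramp u - ramp v| <= `|u - v|.
Proof.
wlog uv : u v / u <= v.
  move=> H; have [/H//|/ltW/H] := leP u v; by rewrite distrC (distrC v).
rewrite ger0_norm ?subr_ge0 ?ramp_decr// distrC ger0_norm ?subr_ge0//.
by have [] := rampP u; have [] := rampP v; move=> [? ->] [? ->]; lra.
Qed.

Lemma ramp_clamp u : 4 - ramp u = Num.max 1 (Num.min 4 u).
Proof.
have [[u1 ->]|[u1 ->]|[u1 ->]] := rampP u.
- by rewrite max_l ?ge_min ?u1 ?orbT//; lra.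
- by rewrite min_r ?max_r//; lra.
- by rewrite min_l ?max_r//; lra.
Qed.

(** The slope of [ln] on [[1, 4]] is at least [1 / 4], applied to the clamps [4 - ramp]. The
    logarithm of a clamp is written as a difference of two terms, ready for telescoping. *)
Lemma ramp_sub_le_ln u v : 0 < u -> u <= v -> ramp u - ramp v <=
  4 * ((ln (Num.max 1 v) - ln (Num.max 1 (v / 4)))
       - (ln (Num.max 1 u) - ln (Num.max 1 (u / 4)))).
Proof.
move=> u0 uv.
have cE w : 0 < w -> ln (4 - ramp w) = ln (Num.max 1 w) - ln (Num.max 1 (w / 4)).
  move=> w0.
  have m1 y : 0 < Num.max 1 y by rewrite lt_max ltr01.
  have -> : Num.max 1 w = (4 - ramp w) * Num.max 1 (w / 4).
    have [[w1 ->]|[w1 ->]|[w1 ->]] := rampP w.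
    - by rewrite !max_l//; lra.
    - by rewrite (max_l (y := w / 4)) ?max_r; lra.
    - by rewrite !max_r; lra.
  by rewrite lnM ?posrE ?addrK// ramp_clamp.
rewrite -!cE ?(lt_le_trans u0)//.
have := ramp_decr uv; have := ramp_le3 u; have := ramp_ge0 v.
set p := ramp u; set q := ramp v => q0 p3 qp.
have q4 : 0 < 4 - q by lra.
have p4 : 0 < 4 - p by lra.
have := ln_le_sub1 (divr_gt0 p4 q4); rewrite ln_div ?posrE// => h.
have : (4 - p) / (4 - q) - 1 = - ((p - q) / (4 - q)) by field; lra.
have : (p - q) / 4 <= (p - q) / (4 - q).
  by rewrite ler_wpM2l ?subr_ge0// lef_pV2 ?posrE//; lra.
lra.
Qed.

Lemma ln_max_sub_le (s x y : R) : 0 < s -> 0 < y -> y <= x ->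
  ln (Num.max 1 (s * x)) - ln (Num.max 1 (s * y)) <= ln (x / y).
Proof.
move=> s0 y0 yx.
have x0 := lt_le_trans y0 yx.
have m1 (w : R) : 0 < Num.max 1 w by rewrite lt_max ltr01.
rewrite -ln_div ?posrE// ler_ln ?posrE ?divr_gt0//.
rewrite ler_pdivrMr// ge_max; apply/andP; split.
  have h1 : 1 <= x / y by rewrite ler_pdivlMr ?mul1r.
  by rewrite -[X in X <= _]mulr1 ler_pM// le_max lexx.
rewrite (_ : s * x = x / y * (s * y)); last by field; rewrite gt_eqF.
by rewrite ler_wpM2l ?le_max ?lexx ?orbT// divr_ge0// ltW.
Qed.

(** Going from [y] to [x] crosses about [ln (x / y)] scales, and the bound does not depend on the
    number of scales in the sum. This is what matches the logarithm in the L2 condition. *)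
Lemma sum_ramp_sub_le_ln m N x y : 0 < y -> y <= x ->
  \sum_(m <= n < N) (ramp (4 ^+ n * y) - ramp (4 ^+ n * x)) <= 4 * ln (x / y).
Proof.
move=> y0 yx; have x0 := lt_le_trans y0 yx.
have lnxy : 0 <= ln (x / y) by rewrite ln_ge0// ler_pdivlMr// mul1r.
have [Nm|mN] := leqP N m; first by rewrite big_geq// mulr_ge0.
(* The scale is [4 ^+ (n - 1)], written as a quotient so that [n = 0] is allowed; [T w n.+1 - T w n]
   is the logarithm of the clamp of [4 ^+ n * w]. *)
pose T (w : R) n := ln (Num.max 1 (4 ^+ n / 4 * w)).
have TS (w : R) n : T w n.+1 = ln (Num.max 1 (4 ^+ n * w)).
  by rewrite /T exprSr mulfK.
have p4 n : 0 < 4 ^+ n :> R by rewrite exprn_gt0.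
apply: (@le_trans _ _ (\sum_(m <= n < N) 4 * ((T x n.+1 - T y n.+1) - (T x n - T y n)))).
  apply: ler_sum => n _.
  have h := @ramp_sub_le_ln (4 ^+ n * y) (4 ^+ n * x) (mulr_gt0 (p4 n) y0)
    (ler_wpM2l (ltW (p4 n)) yx).
  apply: (le_trans h).
  have e (w : R) : 4 ^+ n / 4 * w = 4 ^+ n * w / 4 by rewrite mulrAC.
  rewrite !TS /T !e; lra.
rewrite -mulr_sumr ler_wpM2l// telescope_sumr ?(ltnW mN)//.
have h1 : T x N - T y N <= ln (x / y) by apply: ln_max_sub_le => //; rewrite divr_gt0.
suff : T y m <= T x m by lra.
have m1 (w : R) : 0 < Num.max 1 w by rewrite lt_max ltr01.
rewrite /T ler_ln ?posrE// ge_max le_max lexx/= le_max; apply/orP; right.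
by rewrite ler_wpM2l// divr_ge0// ltW.
Qed.

Definition profile a (m N : nat) x : R :=
  \sum_(m <= n < N) a n * ramp (4 ^+ n * x).

(** The last term serves the points with [x > 4 / 4 ^+ m]: every indicator vanishes there, yet
    points closer to [E] still see a different profile. *)
Definition profile_energy a (m N : nat) x : R :=
  \sum_(m <= n < N) a n ^+ 2 * 4 ^+ n * (x <= 4 / 4 ^+ n)%R%:R + a m ^+ 2 * 4 ^+ m.

Lemma profile_energy_ge0 a m N x : 0 <= profile_energy a m N x.
Proof.
have c0 n : 0 <= a n ^+ 2 * 4 ^+ n by rewrite mulr_ge0 ?sqr_ge0 ?exprn_ge0.
by rewrite /profile_energy addr_ge0// sumr_ge0// => n _; rewrite mulr_ge0.
Qed.

Section nonneg.
Variable (a : nat -> R) (m N : nat).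
Hypothesis a_ge0 : forall n, (m <= n)%N -> 0 <= a n.

Lemma profile_ge0 x : 0 <= profile a m N x.
Proof.
rewrite /profile big_nat_cond; apply: sumr_ge0 => n /andP[/andP[mn _] _].
by rewrite mulr_ge0 ?a_ge0 ?ramp_ge0.
Qed.

Lemma profile_le x : profile a m N x <= 3 * \sum_(m <= n < N) a n.
Proof.
rewrite /profile mulr_sumr; apply: ler_sum_nat => n /andP[mn _].
by rewrite [leRHS]mulrC ler_wpM2l ?a_ge0 ?ramp_le3.
Qed.

Lemma profile_lipschitz x y :
  `|profile a m N x - profile a m N y| <=
    (\sum_(m <= n < N) a n * 4 ^+ n) * `|x - y|.
Proof.
rewrite /profile -sumrB (le_trans (ler_norm_sum _ _ _))// mulr_suml.
apply: ler_sum_nat => n /andP[mn _].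
rewrite -mulrBr normrM ger0_norm ?a_ge0// -mulrA ler_wpM2l ?a_ge0//.
by rewrite (le_trans (ramp_lipschitz _ _))// -mulrBr normrM ger0_norm.
Qed.

Lemma profile_decr x y : x <= y -> profile a m N y <= profile a m N x.
Proof.
move=> xy; apply: ler_sum_nat => n /andP[mn _].
by rewrite ler_wpM2l ?a_ge0// ramp_decr// ler_wpM2l// exprn_ge0.
Qed.

Lemma profile_eq x : x <= (4 ^+ N)^-1 -> profile a m N x = 3 * \sum_(m <= n < N) a n.
Proof.
move=> xN; rewrite /profile mulr_sumr; apply: eq_big_nat => n /andP[_ nN].
rewrite ramp_eq3; first exact: mulrC.
rewrite (le_trans (ler_wpM2l _ xN)) ?exprn_ge0//.
rewrite ler_pdivrMr ?exprn_gt0// mul1r ler_weXn2l ?ler1n//.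
exact: ltnW.
Qed.

(** For fixed [p] this bound does not depend on [N], so it becomes negligible after division by the
    full sum of weights. *)
Lemma profile_tail p x : (m <= p <= N)%N -> 4 / 4 ^+ p <= x ->
  profile a m N x <= 3 * \sum_(m <= n < p) a n.
Proof.
move=> /andP[mp pN] px; rewrite /profile (@big_cat_nat _ _ _ p)//=.
rewrite [X in _ + X]big_nat_cond [X in _ + X]big1 ?addr0.
  rewrite mulr_sumr; apply: ler_sum_nat => n /andP[mn _].
  by rewrite [leRHS]mulrC ler_wpM2l ?a_ge0 ?ramp_le3.
move=> n /andP[/andP[pn _] _]; rewrite ramp_eq0 ?mulr0//.
have p4 : 0 < 4 ^+ p :> R by rewrite exprn_gt0.
have x0 : 0 <= x by rewrite (le_trans _ px)// divr_ge0// ltW.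
move: px; rewrite ler_pdivrMr// => /le_trans; apply.
by rewrite mulrC ler_wpM2r// ler_weXn2l// ler1n.
Qed.

(** Weighted Cauchy-Schwarz: with [s] the sum on the left, expand the nonnegative sum of
    [c n * v n * (b n - s / K / v n) ^+ 2]. Only an upper bound [K] of the dual sum is required. *)
Lemma sumr_sqr_le (b c v : nat -> R) (K : R) :
  (forall n, 0 <= c n) -> (forall n, 0 < v n) -> 0 < K ->
  \sum_(m <= n < N) c n / v n <= K ->
  (\sum_(m <= n < N) b n * c n) ^+ 2
    <= K * \sum_(m <= n < N) b n ^+ 2 * (c n * v n).
Proof.
move=> c0 v0 K0 cK; set s := \sum_(m <= n < N) b n * c n.
have : 0 <= \sum_(m <= n < N) c n * v n * (b n - s / K / v n) ^+ 2.
  by apply: sumr_ge0 => n _; rewrite mulr_ge0 ?sqr_ge0// mulr_ge0// ltW.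
have -> : \sum_(m <= n < N) c n * v n * (b n - s / K / v n) ^+ 2 =
    \sum_(m <= n < N) b n ^+ 2 * (c n * v n) - s / K * 2 * s
    + (s / K) ^+ 2 * \sum_(m <= n < N) c n / v n.
  rewrite {3}/s !mulr_sumr -sumrB -big_split/=; apply: eq_bigr => n _.
  by field; rewrite !gt_eqF.
set X := \sum_(m <= n < N) b n ^+ 2 * _; set Y := \sum_(m <= n < N) _ / _ in cK *.
move=> h; have h2 : (s / K) ^+ 2 * Y <= (s / K) ^+ 2 * K.
  by rewrite ler_wpM2l ?sqr_ge0.
have e1 : (s / K) ^+ 2 * K = s ^+ 2 / K by field; rewrite gt_eqF.
have e2 : s / K * 2 * s = 2 * (s ^+ 2 / K) by field; rewrite gt_eqF.
rewrite -ler_pdivrMl// mulrC; rewrite e2 in h; rewrite e1 in h2; lra.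
Qed.

(** With [v = 2 ^+ n * Num.sqrt r] the term is the smaller of [v] and [v^-1], a two-sided geometric
    series. It is dominated by 6 times the increment of [v / (1 + v)] when [v] doubles, and 6 is the
    value at [v = 1] of the denominator [(1 + 2 v) * (1 + v)] of that increment. *)
Lemma sum_min_dyadic_le r : 0 < r ->
  \sum_(m <= n < N) Num.min 1 (4 ^+ n * r) / (2 ^+ n * Num.sqrt r) <= 6.
Proof.
move=> r0; have [Nm|mN] := leqP N m; first by rewrite big_geq.
have s0 : 0 < Num.sqrt r by rewrite sqrtr_gt0.
pose v n := 2 ^+ n * Num.sqrt r.
have v0 n : 0 < v n by rewrite mulr_gt0// exprn_gt0.
pose T n := v n / (1 + v n).
apply: (@le_trans _ _ (\sum_(m <= n < N) 6 * (T n.+1 - T n))).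
  apply: ler_sum => n _; rewrite -/(v n).
  have -> : 4 ^+ n * r = v n ^+ 2.
    by rewrite /v exprMn sqr_sqrtr ?ltW// exprAC; congr (_ ^+ n * _); rewrite expr2 -natrM.
  have vS : v n.+1 = 2 * v n by rewrite /v exprS mulrA.
  have {}v0 := v0 n; rewrite /T vS; set w := v n in v0 *.
  have -> : 6 * (2 * w / (1 + 2 * w) - w / (1 + w)) = 6 * w / ((1 + 2 * w) * (1 + w)).
    by field; lra.
  rewrite ler_pdivrMr// mulrAC ler_pdivlMr; last by rewrite mulr_gt0//; lra.
  have [w1|w1] := leP 1 w.
    by rewrite min_l ?exprn_ege1//; nra.
  rewrite min_r; last by rewrite expr_le1 ?ltW.
  rewrite (_ : 6 * w * w = w ^+ 2 * 6); last by ring.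
  by rewrite ler_wpM2l ?sqr_ge0//; nra.
rewrite -mulr_sumr telescope_sumr ?(ltnW mN)//.
have T1 n : 0 <= T n <= 1.
  have := v0 n; rewrite /T; set w := v n => w0.
  by rewrite divr_ge0 ?ler_pdivrMr//=; lra.
by have := T1 N; have := T1 m; lra.
Qed.

(* Cauchy-Schwarz with weights [2 ^+ n * Num.sqrt r]; the right-hand side is
   integrable in [r] against [dr / r ^+ 2]. *)
Lemma profile_far x y r : 0 < r -> x <= y -> y <= x + r ->
  (profile a m N x - profile a m N y) ^+ 2 <= 54 *
    \sum_(m <= n < N) (a n ^+ 2 * (x <= 4 / 4 ^+ n)%R%:R) *
      (Num.min 1 (4 ^+ n * r) * (2 ^+ n * Num.sqrt r)).
Proof.
move=> r0 xy yxr.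
pose b n := a n * (x <= 4 / 4 ^+ n)%R%:R.
pose c n := Num.min 1 (4 ^+ n * r).
have c0 n : 0 <= c n by rewrite le_min ler01 mulr_ge0 ?exprn_ge0 ?ltW.
have h1 : 0 <= profile a m N x - profile a m N y.
  by rewrite subr_ge0 profile_decr.
(* A ramp difference is at most 3 and at most [4 ^+ n * r], hence at most [3 * c n]; if
   [x > 4 / 4 ^+ n], both ramps vanish. *)
have h2 : profile a m N x - profile a m N y <= 3 * \sum_(m <= n < N) b n * c n.
  rewrite /profile -sumrB mulr_sumr; apply: ler_sum_nat => n /andP[mn _].
  have p4 : 0 < 4 ^+ n :> R by rewrite exprn_gt0.
  rewrite -mulrBr /b /c; have [xn|xn] := leP x (4 / 4 ^+ n); last first.
    rewrite !ramp_eq0 ?subrr ?mulr0 ?mul0r ?mulr0//.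
      by rewrite mulrC -ler_pdivrMr// ltW// (lt_le_trans xn).
    by rewrite mulrC -ler_pdivrMr// ltW.
  rewrite mulr1 mulrCA ler_wpM2l ?a_ge0//.
  have := ramp_le3 (4 ^+ n * x); have := ramp_ge0 (4 ^+ n * y).
  have := ramp_lipschitz (4 ^+ n * x) (4 ^+ n * y).
  rewrite [X in _ <= X]distrC -mulrBr (ger0_norm (mulr_ge0 (ltW p4) _)) ?subr_ge0//.
  have : 4 ^+ n * (y - x) <= 4 ^+ n * r by rewrite ler_wpM2l ?(ltW p4)//; lra.
  move=> h3 /(le_trans (ler_norm _)) h4 h5 h6.
  have := mulr_gt0 p4 r0.
  by have [h|h] := leP 1 (4 ^+ n * r); lra.
have h3 : (profile a m N x - profile a m N y) ^+ 2
    <= 3 ^+ 2 * (\sum_(m <= n < N) b n * c n) ^+ 2.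
  by rewrite -exprMn ler_sqr ?nnegrE// (le_trans h1).
rewrite (le_trans h3)//.
have := @sumr_sqr_le b c (fun n => 2 ^+ n * Num.sqrt r) 6 c0.
move=> /(_ _ _ (sum_min_dyadic_le r0)) h4.
have {}h4 := h4 (fun n => mulr_gt0 (exprn_gt0 n (ltr0n R 2)) (etrans (sqrtr_gt0 r) r0)) (ltr0n R 6).
rewrite (_ : 54 = 3 ^+ 2 * 6); last by rewrite expr2 -!natrM.
rewrite -mulrA ler_wpM2l ?exprn_ge0// (le_trans h4)// ler_wpM2l//.
rewrite le_eqVlt; apply/orP; left; apply/eqP; apply: eq_bigr => n _.
by rewrite /b exprMn; congr (_ * _ * _); case: (_ <= _); rewrite ?expr1n ?expr0n.
Qed.

(** Let [k] be the first scale with [4 ^+ k * x > 1]. At earlier scales both ramps sit on the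
    plateau and cancel; from [k] on the weights are at most [A = a k]. Since [1 / x < 4 ^+ k], the
    quotient [A ^+ 2 / x] is paid by the term [k] of the energy, active because [4 ^+ k * x <= 4] if
    [k > m], and by the additional term if [k = m]. *)
Lemma profile_near x : {in [pred n | (m <= n)%N] &, {homo a : i j / (i <= j)%N >-> j <= i}} ->
  (m < N)%N -> 0 < x ->
  exists A, [/\ 0 <= A, A ^+ 2 / x <= profile_energy a m N x &
    forall y, 0 < y -> y <= x ->
      profile a m N y - profile a m N x <= 4 * A * ln (x / y)].
Proof.
move=> a_decr mN x0.
have Q0 n : 0 <= a n ^+ 2 * 4 ^+ n by rewrite mulr_ge0 ?sqr_ge0 ?exprn_ge0.
have Q1 n : 0 <= a n ^+ 2 * 4 ^+ n * (x <= 4 / 4 ^+ n)%R%:R by rewrite mulr_ge0.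
have ex : exists n, (m <= n)%N && (1 < 4 ^+ n * x).
  exists (maxn m (Num.bound x^-1)); rewrite leq_maxl/=.
  rewrite -ltr_pdivrMr// mul1r (lt_le_trans (archi_boundP _)) ?invr_ge0 ?(ltW x0)//.
  rewrite -natrX ler_nat (leq_trans (leq_maxr m _))//.
  by rewrite ltnW// ltn_expl.
case: (ex_minnP ex) => k /andP[mk kx] kmin.
have small n : (m <= n)%N -> (n < k)%N -> 4 ^+ n * x <= 1.
  move=> mn nk; rewrite leNgt; apply/negP => h.
  by have := kmin n; rewrite mn h leqNgt nk => /(_ isT).
have zero n y : (m <= n)%N -> (n < k)%N -> y <= x ->
    ramp (4 ^+ n * y) - ramp (4 ^+ n * x) = 0.
  move=> mn nk yx; have nx := small _ mn nk.
  by rewrite !ramp_eq3 ?subrr// (le_trans _ nx)// ler_wpM2l ?exprn_ge0.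
(* If [k >= N], every ramp in the sum is on its plateau at [x] and at [y], and [A = 0] works. *)
have [kN|Nk] := ltnP k N; last first.
  exists 0; split => //.
    by rewrite expr0n mul0r addr_ge0// sumr_ge0.
  move=> y y0 yx; rewrite mulr0 mul0r /profile -sumrB big_nat_cond big1// => n.
  move=> /andP[/andP[mn nN] _]; rewrite -mulrBr zero ?mulr0//.
  exact: leq_trans Nk.
exists (a k); split; first exact: a_ge0.
  have h : a k ^+ 2 / x <= a k ^+ 2 * 4 ^+ k.
    rewrite ler_wpM2l ?sqr_ge0// -[leLHS]mul1r ler_pdivrMr//; exact: ltW.
  rewrite (le_trans h)//; have [<-|mk'] := eqVneq m k.
    by rewrite /profile_energy lerDr sumr_ge0.
  have {mk'}mk' : (m < k)%N by rewrite ltn_neqAle mk' mk.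
  rewrite /profile_energy (big_cat_nat (n := k))//=; last exact: ltnW.
  rewrite (big_ltn kN) addrCA -addrA (_ : (x <= _) = true) ?mulr1.
    by rewrite lerDl addr_ge0 ?sumr_ge0// addr_ge0 ?sumr_ge0.
  case: k mk' kN small {mk kx kmin zero h} => // k mk' kN small.
  have := small k mk' (leqnn _).
  rewrite exprS invfM mulrA divff// mul1r -[_^-1]mul1r ler_pdivlMr ?exprn_gt0//.
  by rewrite mulrC.
move=> y y0 yx.
apply: (@le_trans _ _ (\sum_(m <= n < N) a k * (ramp (4 ^+ n * y) - ramp (4 ^+ n * x)))).
  rewrite /profile -sumrB; apply: ler_sum_nat => n /andP[mn nN].
  rewrite -mulrBr; have [nk|kn] := ltnP n k; first by rewrite zero// !mulr0.
  rewrite ler_wpM2r ?a_decr//; rewrite subr_ge0 ramp_decr// ler_wpM2l// exprn_ge0//.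
rewrite -mulr_sumr -[leRHS]mulrA [leRHS]mulrCA ler_wpM2l ?a_ge0//.
exact: sum_ramp_sub_le_ln.
Qed.

End nonneg.

(** The factor [x - y] will cancel against the chord, and the fourth root, once squared, leaves the
    integrable singularity [y ^ (- 1 / 2)]. With [s] the fourth root of [x / y]:
    [ln (x / y) = 4 * ln s <= 4 * (s - 1)] and [(s - 1) * s ^+ 4 <= s * (s ^+ 4 - 1)]. *)
Lemma ln_mul_le x y : 0 < y -> y <= x ->
  ln (x / y) * x <= 4 * Num.sqrt (Num.sqrt (x / y)) * (x - y).
Proof.
move=> y0 yx; have x0 := lt_le_trans y0 yx.
have q1 : 1 <= x / y by rewrite ler_pdivlMr// mul1r.
set s := Num.sqrt (Num.sqrt (x / y)).
have s1 : 1 <= s by rewrite -[1]sqrtr1 ler_sqrt// -[1]sqrtr1 ler_sqrt// (le_trans ler01).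
have s0 := lt_le_trans ltr01 s1.
have s4 : x / y = s ^+ 4.
  by rewrite (exprM s 2 2) sqr_sqrtr ?sqrtr_ge0// sqr_sqrtr// (le_trans ler01).
have xE : x = s ^+ 4 * y by rewrite -s4 divfK// gt_eqF.
have lnE : ln (x / y) = 4 * ln s by rewrite s4 lnXn// mulr_natl.
have lns : ln s <= s - 1.
  exact: ln_le_sub1.
rewrite lnE -[leLHS]mulrA -[leRHS]mulrA ler_wpM2l// xE.
have h : ln s * (s ^+ 4 * y) <= (s - 1) * (s ^+ 4 * y).
  by rewrite ler_wpM2r// mulr_ge0 ?exprn_ge0// ltW.
rewrite (le_trans h)//.
have -> : s * (s ^+ 4 * y - y) = (s - 1) * (s ^+ 4 * y) + (s ^+ 4 - s) * y by ring.
rewrite lerDl mulr_ge0 ?(ltW y0)// subr_ge0.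
by rewrite exprS ler_peMr ?(ltW s0)// exprn_ege1.
Qed.

End profile.

(** * The energy estimate *)

Section energy.
Context {R : realType}.
Implicit Types (z w : R * R) (a : nat -> R).
Local Open Scope ereal_scope.

Lemma ge0_integral_setU_eq d (T : measurableType d) (mu : {measure set T -> \bar R})
    (D A B : set T) (f : T -> \bar R) :
  measurable A -> measurable B -> measurable_fun D f ->
  (forall x, D x -> 0 <= f x) -> D = A `|` B -> [disjoint A & B] ->
  \int[mu]_(x in D) f x = \int[mu]_(x in A) f x + \int[mu]_(x in B) f x.
Proof.
move=> mA mB mf f0 DE AB; move: mf f0; rewrite DE => mf f0.
by rewrite ge0_integral_setU.
Qed.

(** The coefficient of scale [n] in [profile_far], divided by the square of the distance. *)
Definition dyadic_kernel (n : nat) (r : R) : R :=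
  (Num.min 1 (4 ^+ n * r) * (2 ^+ n * Num.sqrt r) / r ^+ 2)%R.

Lemma dyadic_kernel_ge0 n r : (0 <= r -> 0 <= dyadic_kernel n r)%R.
Proof.
move=> r0; rewrite /dyadic_kernel divr_ge0 ?sqr_ge0// !mulr_ge0 ?exprn_ge0//.
by rewrite le_min ler01 mulr_ge0 ?exprn_ge0.
Qed.

Lemma measurable_dyadic_kernel n z : circle z ->
  measurable_fun circle (fun w => dyadic_kernel n (arcdist z w)).
Proof.
move=> cz; have mr := measurable_arcdist cz.
apply: measurable_funM.
  apply: measurable_funM.
    apply: measurable_minr; first exact: measurable_cst.
    by apply: measurable_funM => //; exact: measurable_cst.
  apply: measurable_funM; first exact: measurable_cst.
  exact: measurable_fun_sqrtr.
apply: measurable_funV_ge0; first by move=> w _; exact: sqr_ge0.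
exact: measurable_funX.
Qed.

(** Cut at [r = 4 ^- n]. Below, the kernel is at most [8 ^+ n / Num.sqrt r], which contributes
    [24 * 4 ^+ n]; above, at most [2 ^+ n / (r * Num.sqrt r)], which contributes [48 * 4 ^+ n]. *)
Lemma integral_dyadic_kernel n z : circle z ->
  \int[arclength]_(w in circle) (dyadic_kernel n (arcdist z w))%:E
    <= (72 * 4 ^+ n)%:E.
Proof.
move=> cz; have mr := measurable_arcdist cz; have mc := @measurable_circle R.
pose t : R := ((4 ^+ n)^-1)%R.
have p4 : (0 < 4 ^+ n :> R)%R by rewrite exprn_gt0.
have p2 : (0 < 2 ^+ n :> R)%R by rewrite exprn_gt0.
have p42 : (4 ^+ n = 2 ^+ n * 2 ^+ n :> R)%R by rewrite -exprMn -natrM.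
have t0 : (0 < t)%R by rewrite invr_gt0.
have st : Num.sqrt t = ((2 ^+ n)^-1)%R.
  by rewrite /t p42 invfM -expr2 sqrtr_sqr ger0_norm// invr_ge0 ltW.
pose A := circle `&` [set w | (arcdist z w <= t)%R].
pose B := circle `&` [set w | (t < arcdist z w)%R].
have mA : measurable A by exact: measurable_arcball.
have BE : B = circle `\` A.
  apply/seteqP; split => w [cw]; rewrite /A/B/=.
    by move=> tw; split => // -[_]; rewrite leNgt tw.
  by move=> h; split => //; rewrite ltNge; apply/negP => h'; apply: h.
have mB : measurable B by rewrite BE; exact: measurableD.
have mballs D s : D `<=` circle -> measurable D -> (0 < s)%R ->
    arclength (D `&` [set w | (arcdist z w <= s)%R]) <= (6 * s)%:E.
  move=> Dc mD s0; apply: le_trans (arclength_arcball cz s0).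
  apply: le_measure; rewrite ?inE; last by move=> w [/Dc].
    apply: (measurable_fun_le mD); last exact: measurable_cst.
    exact: measurable_funS mr.
  exact: measurable_arcball.
have Ac : A `<=` circle by move=> w [].
have Bc : B `<=` circle by move=> w [].
rewrite (@ge0_integral_setU_eq _ _ arclength _ A B)//; first last.
- by apply/disj_setPS => w [[_ /= h1] [_ /=]]; rewrite ltNge h1.
- by rewrite BE setDUK.
- by move=> w cw; rewrite lee_fin dyadic_kernel_ge0// arcdist_ge0.
- by apply/measurable_EFinP; exact: measurable_dyadic_kernel.
have -> : (72 * 4 ^+ n)%:E = (8 ^+ n)%:E * (4 * 6 * Num.sqrt t)%:E
    + (2 ^+ n)%:E * (8 * 6 / Num.sqrt t)%:E :> \bar R.
  rewrite -!EFinM -EFinD; congr EFin; rewrite st invrK p42.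
  rewrite (_ : 8 ^+ n = 2 ^+ n * 2 ^+ n * 2 ^+ n :> R)%R; last by rewrite -!exprMn -!natrM.
  by field; rewrite gt_eqF.
have r0 w : circle w -> (0 <= arcdist z w)%R by exact: arcdist_ge0.
have msq D : D `<=` circle -> measurable_fun D (fun w => Num.sqrt (arcdist z w)).
  by move=> Dc; apply: measurable_funS (measurable_fun_sqrtr mr).
apply: leeD.
  apply: (@le_trans _ _ (\int[arclength]_(w in A)
      ((8 ^+ n)%:E * ((Num.sqrt (arcdist z w))^-1)%:E))).
    apply: ge0_le_integral_nonmeasurable => w [cw /= wt].
      by rewrite lee_fin dyadic_kernel_ge0// r0.
    rewrite -EFinM lee_fin /dyadic_kernel.
    have := r0 _ cw; rewrite le_eqVlt => /predU1P[<-|rw0].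
      by rewrite sqrtr0 !mulr0 mul0r invr0 mulr0.
    set r := arcdist z w in wt rw0 *.
    have s0 : (0 < Num.sqrt r)%R by rewrite sqrtr_gt0.
    rewrite ler_pdivrMr ?exprn_gt0//.
    apply: (@le_trans _ _ ((4 ^+ n * r) * (2 ^+ n * Num.sqrt r))%R).
      by rewrite ler_wpM2r ?mulr_ge0 ?exprn_ge0// ge_min lexx orbT.
    have := sqr_sqrtr (ltW rw0); move: s0; set s := Num.sqrt r => s0 <-.
    rewrite (_ : 8 ^+ n = 4 ^+ n * 2 ^+ n :> R)%R; last by rewrite -!exprMn -!natrM.
    rewrite le_eqVlt; apply/orP; left; apply/eqP; field.
    by rewrite gt_eqF.
  rewrite ge0_integralZl_EFin//.
    rewrite lee_pmul// ?integral_ge0//.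
    apply: integral_sqrtV_le => //.
    - exact: measurable_funS mr.
    - by move=> w [cw /= wt]; rewrite r0.
    - by move=> s s0; exact: mballs.
  apply/measurable_EFinP; apply: measurable_funV_ge0 => //.
  exact: msq.
apply: (@le_trans _ _ (\int[arclength]_(w in B)
    ((2 ^+ n)%:E * ((arcdist z w * Num.sqrt (arcdist z w))^-1)%:E))).
  apply: ge0_le_integral_nonmeasurable => w [cw /= wt].
    by rewrite lee_fin dyadic_kernel_ge0// r0.
  rewrite -EFinM lee_fin /dyadic_kernel.
  have rw0 := lt_trans t0 wt.
  set r := arcdist z w in wt rw0 *.
  have s0 : (0 < Num.sqrt r)%R by rewrite sqrtr_gt0.
  rewrite ler_pdivrMr ?exprn_gt0//.
  apply: (@le_trans _ _ (1 * (2 ^+ n * Num.sqrt r))%R).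
    by rewrite ler_wpM2r ?mulr_ge0 ?exprn_ge0// ge_min lexx.
  have := sqr_sqrtr (ltW rw0); move: s0; set s := Num.sqrt r => s0 <-.
  rewrite le_eqVlt; apply/orP; left; apply/eqP; field.
  by rewrite gt_eqF.
rewrite ge0_integralZl_EFin//.
- rewrite lee_pmul// ?integral_ge0//.
    by move=> w [cw _]; rewrite lee_fin invr_ge0 mulr_ge0// r0.
  apply: integral_sqrt3V_le => //.
  - exact: measurable_funS mr.
  - by move=> w [cw /= /ltW].
  - by move=> s s0; exact: mballs.
- by move=> w [cw _]; rewrite lee_fin invr_ge0 mulr_ge0// r0.
apply/measurable_EFinP; apply: measurable_funV_ge0.
  by move=> w [cw _]; rewrite mulr_ge0// r0.
apply: measurable_funM; last exact: msq.
exact: measurable_funS mr.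
Qed.

End energy.

(** * Energy of the profile at a single point *)

Section energy_estimate.
Context {R : realType}.
Variable E : set (R * R).
Hypotheses (E0 : E !=set0) (Ecircle : E `<=` circle) (Eclosed : closed E).
Hypothesis Enull : arclength E = 0%E.
Implicit Types (z w : R * R).
Local Open Scope ereal_scope.

Lemma measurable_dist : measurable_fun circle (fun w => dist w E).
Proof.
apply: (@lipschitz_measurable_fun _ 1) => // z w cz cw.
by rewrite mul1r; exact: dist_lipschitz.
Qed.

Lemma measurable_dist_le D (t : R) : measurable D -> D `<=` circle ->
  measurable (D `&` [set w | (dist w E <= t)%R]).
Proof.
move=> mD Dc; apply: measurable_fun_le; [exact: mD| |exact: measurable_cst].
by apply: measurable_funS measurable_dist => //; exact: measurable_circle.
Qed.

Lemma measurable_thickening (t : R) : measurable (thickening E t).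
Proof.
exact: measurable_dist_le (@measurable_circle R) _.
Qed.

Lemma measurable_E : measurable E.
Proof. exact: closed_measurable_prod. Qed.

(** Inside one component, closeness to [E] means closeness to one of two end points, so two arc
    balls suffice and the length is linear in [t]. For the thickening of all of [E] no such bound is
    available. *)
Lemma arclength_arc_component z (t : R) : (circle `\` E) z -> (0 < t)%R ->
  arclength (arc_component z E `&` [set w | (dist w E <= t)%R]) <= (12 * t)%:E.
Proof.
move=> Ez t0; have mI := measurable_arc_component E0 Ecircle Eclosed Ez.
have [e1 [e2 [ce1 ce2 Ie]]] := arc_component_dist E0 Ecircle Eclosed Ez.
have Ic : arc_component z E `<=` circle.
  by move=> w /connected_component_sub[].
pose ball e := circle `&` [set w | (arcdist e w <= t)%R].
have mb e : circle e -> measurable (ball e) by move=> ce; exact: measurable_arcball.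
apply: (@le_trans _ _ (arclength (ball e1 `|` ball e2))).
  apply: le_measure; rewrite ?inE.
  - exact: measurable_dist_le.
  - by apply: measurableU; exact: mb.
  - move=> w [Iw /= wt]; have cw := Ic _ Iw.
    by case: (Ie _ Iw) => h; [left|right]; split => //=;
      rewrite arcdistC (le_trans h).
apply: (@le_trans _ _ (arclength (ball e1) + arclength (ball e2))).
  by apply: measureU2; exact: mb.
rewrite (_ : 12 * t = 6 * t + 6 * t)%R; last by ring.
by rewrite EFinD leeD// arclength_arcball.
Qed.

Lemma integral_arc_component z : (circle `\` E) z ->
  \int[arclength]_(w in arc_component z E `&` [set w | (dist w E <= dist z E)%R])
    ((Num.sqrt (dist w E))^-1)%:E <= (48 * Num.sqrt (dist z E))%:E.
Proof.
move=> Ez; have [cz nEz] := Ez.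
have mI := measurable_arc_component E0 Ecircle Eclosed Ez.
have Ic : arc_component z E `<=` circle by move=> w /connected_component_sub[].
have mA t : measurable (arc_component z E `&` [set w | (dist w E <= t)%R]).
  exact: measurable_dist_le.
have z0 : (0 < dist z E)%R.
  rewrite lt_neqAle (dist_ge0 E0 Ecircle cz) andbT; apply/eqP => h.
  by apply: nEz; apply: dist_eq0.
rewrite (_ : 48 = 4 * 12 :> R)%R; last by rewrite -natrM.
apply: integral_sqrtV_le => //.
- by apply: measurable_funS measurable_dist => [|w [/Ic]]; first exact: measurable_circle.
- by move=> w [/Ic cw /= ->]; rewrite (dist_ge0 E0 Ecircle cw).
- move=> t t0; apply: le_trans (arclength_arc_component Ez t0).
  apply: le_measure; rewrite ?inE//; last by move=> w [[? _] ?].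
  by apply: measurable_dist_le => // w [/Ic].
Qed.

Lemma measurable_Gamma z : (circle `\` E) z -> measurable (Gamma z E).
Proof.
move=> Ez; have mI := measurable_arc_component E0 Ecircle Eclosed Ez.
have mc : measurable (circle `\` arc_component z E).
  by apply: measurableD => //; exact: measurable_circle.
rewrite (_ : Gamma z E =
  (circle `\` arc_component z E) `&` [set w | (dist w E <= dist z E)%R])//.
by apply: measurable_dist_le => // w [].
Qed.

Lemma measurable_Gamma_integrand z : circle z -> measurable_fun circle
  (fun w => (ln (dist z E / dist w E) ^+ 2 / modulus (z - w) ^+ 2)%R).
Proof.
move=> cz; have mc := @measurable_circle R.
apply: measurable_funM.
  apply: measurable_funX; apply: measurableT_comp; first exact: measurable_ln.
  apply: measurable_funM; first exact: measurable_cst.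
  apply: measurable_funV_ge0; last exact: measurable_dist.
  by move=> w cw; exact: dist_ge0.
apply: measurable_funV_ge0; first by move=> w _; exact: sqr_ge0.
apply: measurable_funX.
apply: (eq_measurable_fun (fun w => modulus (w - z)%R)).
  by move=> w _; rewrite modulusC.
by apply: measurable_funTS; exact: measurable_modulus_sub.
Qed.

Section profile_function.
Variables (a : nat -> R) (m N : nat).
Hypothesis mN : (m < N)%N.
Hypothesis a_ge0 : forall n, (m <= n)%N -> (0 <= a n)%R.
Hypothesis a_decr :
  {in [pred n | (m <= n)%N] &, {homo a : i j / (i <= j)%N >-> (j <= i)%R}}.
Local Notation F w := (profile a m N (dist w E)).

Lemma profile_dist_lipschitz z w : circle z -> circle w ->
  (`|F z - F w| <= (\sum_(m <= n < N) a n * 4 ^+ n) * arcdist z w)%R.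
Proof.
move=> cz cw; rewrite (le_trans (profile_lipschitz _ a_ge0 _ _))//.
rewrite ler_wpM2l ?dist_lipschitz//.
rewrite big_nat_cond; apply: sumr_ge0 => n /andP[/andP[mn _] _].
by rewrite mulr_ge0 ?a_ge0 ?exprn_ge0.
Qed.

Definition profile_quotient z w : R :=
  (`|F w - F z| ^+ 2 / modulus (w - z) ^+ 2)%R.

Lemma profile_quotient_ge0 z w : (0 <= profile_quotient z w)%R.
Proof. by rewrite divr_ge0 ?sqr_ge0. Qed.

Lemma measurable_profile_quotient z :
  measurable_fun circle (profile_quotient z).
Proof.
have mF : measurable_fun circle (fun w => F w).
  apply: lipschitz_measurable_fun profile_dist_lipschitz.
  rewrite big_nat_cond; apply: sumr_ge0 => n /andP[/andP[mn _] _].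
  by rewrite mulr_ge0 ?a_ge0 ?exprn_ge0.
apply: measurable_funM.
  apply: measurable_funX; apply: measurableT_comp => //.
  by apply: measurable_funB => //; exact: measurable_cst.
apply: measurable_funV_ge0; first by move=> w _; exact: sqr_ge0.
by apply: measurable_funX; apply: measurable_funTS; exact: measurable_modulus_sub.
Qed.

(** The constant collects 54 from [profile_far], 72 from the kernel, and 4 from replacing the
    squared chord by the squared arc. *)
Lemma integral_profile_far z : circle z ->
  \int[arclength]_(w in (circle `\` E) `&` [set w | (dist z E <= dist w E)%R])
    (profile_quotient z w)%:E <= (4 * 54 * 72 * profile_energy a m N (dist z E))%:E.
Proof.
move=> cz; set x := dist z E.
have mc := @measurable_circle R.
have [k k0 kE] : exists2 k : R, (0 <= k)%R & k = (4 * 54)%R.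
  by exists (4 * 54)%R => //; rewrite mulr_ge0.
pose c n : R := (k * (a n ^+ 2 * (x <= 4 / 4 ^+ n)%R%:R))%R.
have c0 n : (0 <= c n)%R by rewrite mulr_ge0// mulr_ge0 ?sqr_ge0.
pose G n w : \bar R := (c n)%:E * (dyadic_kernel n (arcdist z w))%:E.
have dk0 n w : circle w -> (0 <= dyadic_kernel n (arcdist z w))%R.
  by move=> cw; rewrite dyadic_kernel_ge0// arcdist_ge0.
have mdk n : measurable_fun circle
    (fun w => (dyadic_kernel n (arcdist z w))%:E : \bar R).
  by apply/measurable_EFinP; exact: measurable_dyadic_kernel.
have G0 n w : circle w -> 0 <= G n w.
  by move=> cw; rewrite mule_ge0 ?lee_fin ?dk0.
have mG n : measurable_fun circle (G n) by exact: measurable_funeM.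
set D := (_ `&` _); have Dc : D `<=` circle by move=> w [[]].
have mD : measurable D.
  have mDE : measurable (circle `\` E) by apply: measurableD => //; exact: measurable_E.
  apply: measurable_fun_le; [exact: mDE|exact: measurable_cst|].
  by apply: measurable_funS measurable_dist => // w [].
apply: (@le_trans _ _ (\int[arclength]_(w in D) \sum_(m <= n < N) G n w)).
  apply: ge0_le_integral_nonmeasurable => w [[cw nEw] /= xw].
    by rewrite lee_fin profile_quotient_ge0.
  rewrite /G; under eq_bigr do rewrite -EFinM.
  rewrite sumEFin lee_fin /profile_quotient.
  (* At arc distance 0 the Lipschitz bound makes the numerator vanish. *)
  have := arcdist_ge0 cz cw; rewrite le_eqVlt => /predU1P[r0|r0].
    have : F w = F z.
      apply/eqP; rewrite -subr_eq0 -normr_le0.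
      by rewrite (le_trans (profile_dist_lipschitz cw cz))// arcdistC -r0 mulr0.
    move=> ->; rewrite subrr normr0 expr0n mul0r sumr_ge0// => n _.
    by rewrite mulr_ge0// dk0.
  set r := arcdist z w in r0 *.
  have m0 : (r <= 2 * modulus (w - z))%R by rewrite modulusC arcdist_le_modulus.
  have mw0 : (0 < modulus (w - z))%R by lra.
  have xr : (dist w E <= x + r)%R.
    by rewrite /r arcdistC; exact: dist_le_add.
  have := profile_far N a_ge0 r0 xw xr.
  rewrite real_normK ?num_real// -/x -sqrrN opprB => h.
  rewrite ler_pdivrMr ?exprn_gt0// (le_trans h)//.
  apply: (@le_trans _ _ ((\sum_(m <= n < N) c n * dyadic_kernel n r) * (r ^+ 2 / 4))%R).
    rewrite mulr_suml mulr_sumr; apply: ler_sum => n _.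
    rewrite /c kE /dyadic_kernel le_eqVlt; apply/orP; left; apply/eqP.
    by field; rewrite gt_eqF.
  rewrite ler_wpM2l//.
    by apply: sumr_ge0 => n _; rewrite mulr_ge0// dk0.
  have : (r ^+ 2 <= (2 * modulus (w - z)) ^+ 2)%R.
    by rewrite ler_sqr ?nnegrE ?mulr_ge0 ?(ltW r0) ?(ltW mw0).
  by rewrite exprMn; lra.
apply: (@le_trans _ _ (\int[arclength]_(w in circle) \sum_(m <= n < N) G n w)).
  apply: ge0_subset_integral => //.
    by apply: emeasurable_sum.
  by move=> w cw; apply: sume_ge0 => n _; exact: G0.
rewrite ge0_integral_sum//.
apply: (@le_trans _ _ (\sum_(m <= n < N) (c n * (72 * 4 ^+ n))%:E)).
  apply: lee_sum => n _; rewrite ge0_integralZl_EFin//.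
    rewrite (EFinM (c n)) lee_pmul ?lee_fin//; last exact: integral_dyadic_kernel.
    by apply: integral_ge0 => w cw; rewrite lee_fin dk0.
  by move=> w cw; rewrite lee_fin dk0.
rewrite sumEFin lee_fin /profile_energy.
have am0 : (0 <= a m ^+ 2 * 4 ^+ m)%R by rewrite mulr_ge0 ?sqr_ge0 ?exprn_ge0.
rewrite -kE -/x; 
set Q := (\sum_(m <= n < N) (a n ^+ 2 * 4 ^+ n * _))%R.
have -> : (\sum_(m <= n < N) c n * (72 * 4 ^+ n) = k * 72 * Q)%R.
  by rewrite mulr_sumr; apply: eq_bigr => n _; rewrite /c; ring.
by rewrite ler_wpM2l ?mulr_ge0// lerDl.
Qed.

(** Both parts give a multiple of [A ^+ 2 / x], which [profile_near] bounds by the energy. Across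
    components, [16 = 4 ^+ 2] multiplies the constant [C] of the L2 condition. Inside,
    [32 = 4 * 4 * 2] collects [profile_near], [ln_mul_le] and the passage to chords, and 48 comes
    from [integral_arc_component]. *)
Lemma integral_profile_near z (C : R) : (circle `\` E) z -> (0 <= C)%R ->
  \int[arclength]_(w in Gamma z E)
      (ln (dist z E / dist w E) ^+ 2 / modulus (z - w) ^+ 2)%:E
    <= (C / dist z E)%:E ->
  \int[arclength]_(w in (circle `\` E) `&` [set w | (dist w E < dist z E)%R])
    (profile_quotient z w)%:E
    <= ((16 * C + 32 ^+ 2 * 48) * profile_energy a m N (dist z E))%:E.
Proof.
move=> Ez C0 GC; have [cz nEz] := Ez; set x := dist z E in GC *.
have mc := @measurable_circle R.
have mI := measurable_arc_component E0 Ecircle Eclosed Ez.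
have Ic : arc_component z E `<=` circle by move=> w /connected_component_sub[].
have pos w : (circle `\` E) w -> (0 < dist w E)%R.
  move=> [cw nEw]; rewrite lt_neqAle (dist_ge0 E0 Ecircle cw) andbT; apply/eqP => h.
  by apply: nEw; apply: dist_eq0.
have x0 : (0 < x)%R by exact: pos.
have [A [A0 AQ FA]] := profile_near a_ge0 a_decr mN x0.
have near w : (circle `\` E) w -> (dist w E < x)%R ->
    (0 <= F w - F z <= 4 * A * ln (x / dist w E))%R.
  move=> Ew wx; rewrite FA ?pos// ?(ltW wx)// andbT subr_ge0.
  by rewrite profile_decr// ltW.
set D := (_ `&` _).
have Dc : D `<=` circle by move=> w [[]].
have mD : measurable D.
  have mDE : measurable (circle `\` E) by apply: measurableD => //; exact: measurable_E.
  rewrite (_ : D = (circle `\` E) `\`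
      ((circle `\` E) `&` [set w | (x <= dist w E)%R])).
    apply: measurableD => //.
    apply: measurable_fun_le; [exact: mDE|exact: measurable_cst|].
    by apply: measurable_funS measurable_dist => // w [].
  apply/seteqP; split => w [Ew /= h]; split => //.
    by move=> [_ /=]; rewrite leNgt h.
  by rewrite /= ltNge; apply/negP => h'; apply: h.
have mq : measurable_fun circle (fun w => (profile_quotient z w)%:E : \bar R).
  by apply/measurable_EFinP; exact: measurable_profile_quotient.
rewrite (@ge0_integral_setU_eq R _ _ arclength D (D `\` arc_component z E)
  (D `&` arc_component z E))//; first last.
- by apply/disj_setPS => w [[_ ?] [_ ?]].
- by rewrite setUC setUIDK.
- by move=> w _; rewrite lee_fin profile_quotient_ge0.
- exact: measurable_funS mq.
- exact: measurableI.
- exact: measurableD.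
apply: (@le_trans _ _ ((16 * A ^+ 2)%:E * (C / x)%:E +
    (32 ^+ 2 * A ^+ 2 / x ^+ 2 * Num.sqrt x)%:E * (48 * Num.sqrt x)%:E)); last first.
  rewrite -!EFinM -EFinD lee_fin.
  have sx : (0 < Num.sqrt x)%R by rewrite sqrtr_gt0.
  have -> : (16 * A ^+ 2 * (C / x) +
      32 ^+ 2 * A ^+ 2 / x ^+ 2 * Num.sqrt x * (48 * Num.sqrt x) =
      (16 * C + 32 ^+ 2 * 48) * (A ^+ 2 / x))%R.
    have := sqr_sqrtr (ltW x0); move: sx; set s := Num.sqrt x => sx <-.
    by field; rewrite gt_eqF.
  by rewrite ler_wpM2l// addr_ge0// mulr_ge0.
apply: leeD.
  pose g w : R := (ln (x / dist w E) ^+ 2 / modulus (z - w) ^+ 2)%R.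
  have g0 w : (0 <= g w)%R by rewrite divr_ge0 ?sqr_ge0.
  have mg : measurable_fun circle (fun w => (g w)%:E : \bar R).
    by apply/measurable_EFinP; exact: measurable_Gamma_integrand.
  have DG : D `\` arc_component z E `<=` Gamma z E.
    by move=> w [[[cw _] /= wx] nIw]; split => //=; exact: ltW.
  apply: (@le_trans _ _ (\int[arclength]_(w in D `\` arc_component z E)
      ((16 * A ^+ 2)%:E * (g w)%:E))).
    apply: ge0_le_integral_nonmeasurable => w [[Ew /= wx] _].
      by rewrite lee_fin profile_quotient_ge0.
    have /andP[h0 h1] := near _ Ew wx.
    rewrite -EFinM lee_fin /profile_quotient /g mulrA (modulusC z).
    rewrite ler_wpM2r ?invr_ge0 ?sqr_ge0// real_normK ?num_real//.
    rewrite (_ : 16 * A ^+ 2 * _ = (4 * A * ln (x / dist w E)) ^+ 2)%R; last by ring.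
    by rewrite ler_sqr ?nnegrE// (le_trans h0).
  have Gc : Gamma z E `<=` circle by move=> w [[]].
  rewrite ge0_integralZl_EFin//; first last.
  - by rewrite mulr_ge0 ?sqr_ge0.
  - by apply: measurable_funS mg => // w [/Dc].
  - by move=> w _; rewrite lee_fin g0.
  - exact: measurableD.
  rewrite lee_pmul//.
  - by rewrite lee_fin mulr_ge0 ?sqr_ge0.
  - by apply: integral_ge0 => w _; rewrite lee_fin.
  apply: le_trans GC; apply: ge0_subset_integral => //.
  - exact: measurableD.
  - exact: measurable_Gamma.
  - exact: measurable_funS mg.
  - by move=> w _; rewrite lee_fin g0.
(* Inside the component: [x - dist w E] is at most the arc from [z] to [w], so [ln_mul_le] cancels
   the chord and only the inverse square root of [dist w E] remains. *)
pose J := arc_component z E `&` [set w | (dist w E <= x)%R].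
have Jc : J `<=` circle by move=> w [/Ic].
have mJ : measurable J.
  exact: measurable_dist_le.
have mg : measurable_fun J (fun w => ((Num.sqrt (dist w E))^-1)%:E : \bar R).
  apply/measurable_EFinP; apply: measurable_funV_ge0 => //.
  by apply: measurable_fun_sqrtr; exact: measurable_funS measurable_dist.
apply: (@le_trans _ _ (\int[arclength]_(w in D `&` arc_component z E)
    ((32 ^+ 2 * A ^+ 2 / x ^+ 2 * Num.sqrt x)%:E * ((Num.sqrt (dist w E))^-1)%:E))).
  apply: ge0_le_integral_nonmeasurable => w [[Ew /= wx] _].
    by rewrite lee_fin profile_quotient_ge0.
  have [cw _] := Ew; have y0 := pos _ Ew.
  have /andP[h0 h1] := near _ Ew wx.
  rewrite -EFinM lee_fin /profile_quotient; set y := dist w E in wx y0 h1 *.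
  have h2 := ln_mul_le y0 (ltW wx).
  set s := Num.sqrt (Num.sqrt (x / y)) in h2.
  have sE : (s ^+ 2 = Num.sqrt x * (Num.sqrt y)^-1)%R.
    by rewrite sqr_sqrtr ?sqrtr_ge0// sqrtrM ?(ltW x0)// sqrtrV ?(ltW y0).
  have s0 : (0 <= s)%R by exact: sqrtr_ge0.
  have h3 : (x - y <= 2 * modulus (w - z))%R.
    rewrite (modulusC w) (le_trans _ (arcdist_le_modulus cz cw))//.
    by rewrite lerBlDl; exact: dist_le_add.
  have mw0 : (0 < modulus (w - z))%R by lra.
  rewrite ler_pdivrMr ?exprn_gt0//.
  rewrite (_ : _ * modulus (w - z) ^+ 2 =
      (32 * A * s / x * modulus (w - z)) ^+ 2)%R; last first.
    by rewrite -(mulrA (32 ^+ 2 * A ^+ 2 / x ^+ 2)%R) -sE; field; rewrite gt_eqF.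
  rewrite ler_sqr ?nnegrE ?normr_ge0//; last first.
    by rewrite !mulr_ge0 ?invr_ge0 ?(ltW x0) ?(ltW mw0).
  rewrite ger0_norm// (le_trans h1)// -(ler_pM2r x0).
  rewrite (_ : 32 * A * s / x * modulus (w - z) * x =
    4 * A * (4 * s * (2 * modulus (w - z))))%R; last by field; rewrite gt_eqF.
  rewrite -[leLHS]mulrA ler_wpM2l ?mulr_ge0// (le_trans h2)//.
  by rewrite ler_wpM2l// mulr_ge0.
have k0 : (0 <= 32 ^+ 2 * A ^+ 2 / x ^+ 2 * Num.sqrt x)%R.
  by rewrite !mulr_ge0 ?invr_ge0 ?sqr_ge0.
have DJ : D `&` arc_component z E `<=` J.
  by move=> w [[_ /= wx] Iw]; split => //=; exact: ltW.
rewrite ge0_integralZl_EFin//; first last.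
- exact: measurable_funS mg.
- exact: measurableI.
rewrite lee_pmul//; first by apply: integral_ge0.
apply: le_trans (integral_arc_component Ez).
apply: ge0_subset_integral => //; exact: measurableI.
Qed.

End profile_function.
End energy_estimate.

(** * Divergence of the weights *)

Section finite_measures.
Context d (T : measurableType d) (R : realType).
Variable mu : {measure set T -> \bar R}.

Lemma bounded_Lfun2 (f : T -> R) : (mu setT < +oo)%E ->
  measurable_fun setT f -> (forall x, `|f x| <= 1) -> f \in Lfun mu 2%:E.
Proof.
move=> muT mf f1; apply/andP; split; first by rewrite inE.
rewrite inE /= /finite_norm unlock /=; apply: poweR_lty.
apply: le_lt_trans muT; rewrite -[leRHS]mul1e -integral_cst//.
apply: ge0_le_integral_nonmeasurable => x _ /=; rewrite lee_fin ?powR_ge0//.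
by rewrite powR_mulrn// expr_le1.
Qed.
End finite_measures.

Section divergence.
Context {R : realType}.
Variables (h : R -> R) (beta : R).
Hypothesis h_gt0 : forall t : R, 0 < t < 1 -> 0 < h t.
Hypothesis beta01 : 0 < beta < 1.
Hypothesis h_decr : {in `]0, 1[ &, {homo (fun t => h t / t) : s t /~ s <= t}}.
Hypothesis h_incr :
  {in `]0, 1[ &, {homo (fun t => h t / t `^ beta) : s t / s <= t}}.
Hypothesis h_int :
  (\int[lebesgue_measure]_(t in `]0%R, 1%R[) ((h t)^-1)%:E = +oo)%E.

Definition weight (n : nat) : R := (4 ^+ n)^-1 / h (4 ^+ n)^-1.

Lemma expr4V_itv n : (0 < n)%N -> 0 < ((4 ^+ n)^-1 : R) < 1.
Proof.
move=> n0; rewrite invr_gt0 exprn_gt0//= invf_lt1 ?exprn_gt0//.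
by rewrite exprn_egt1 ?ltr1n// -lt0n.
Qed.

Lemma weight_gt0 n : (0 < n)%N -> 0 < weight n.
Proof.
by move=> n0; rewrite divr_gt0 ?invr_gt0 ?exprn_gt0// h_gt0// expr4V_itv.
Qed.

Lemma div_h_le s t : 0 < s -> s <= t -> t < 1 -> s / h s <= t / h t.
Proof.
move=> s0 st t1; have t0 := lt_le_trans s0 st; have s1 := le_lt_trans st t1.
have hs : 0 < h s by rewrite h_gt0// s0.
have ht : 0 < h t by rewrite h_gt0// t0.
have := @h_decr t s; rewrite !in_itv/= s0 s1 t0 t1 => /(_ isT isT st).
by rewrite -[s / _]invf_div -[t / h t]invf_div lef_pV2 ?posrE ?divr_gt0.
Qed.

Lemma weight_decr :
  {in [pred n | (0 < n)%N] &, {homo weight : i j / (i <= j)%N >-> j <= i}}.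
Proof.
move=> i j i0 j0 ij; have /andP[_ i1] := expr4V_itv i0.
apply: div_h_le => //.
by rewrite lef_pV2 ?posrE ?exprn_gt0// ler_weXn2l// ler1n.
Qed.

(** For [4 ^- n.+1 < t <= 4 ^- n] with [n >= 1], monotonicity of [t / h t] gives [1 / h t <= weight
    n / t <= 4 ^+ n.+1 * weight n]; a bound [B] on the sums would bound the integral. *)
Lemma weight_sum_unbounded (B : R) : exists N, B < \sum_(1 <= n < N) weight n.
Proof.
apply: contrapT => /forallNP sumB.
pose c n := if n is 0 then (h 4^-1)^-1 else weight n * 4 ^+ n.+1.
pose A n : set R := `]0, 1[%classic `&` [set t | t <= (4 ^+ n)^-1].
have q1 : 0 < (4^-1 : R) < 1 by have := @expr4V_itv 1; rewrite expr1; apply.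
have hq : 0 < h 4^-1 by rewrite h_gt0.
have mA n : measurable (A n).
  rewrite (_ : A n = `]0, 1[%classic `&` `]-oo, (4 ^+ n)^-1]%classic).
    by apply: measurableI; exact: measurable_itv.
  by apply/seteqP; split => t [? /= ?]; split => //; rewrite /= in_itv/= in *.
have bound : (\int[lebesgue_measure]_(t in `]0%R, 1%R[) ((h t)^-1)%:E
    <= ((h 4^-1)^-1 + 4 * B)%:E)%E.
  apply: (@ge0_integral_cover_le _ _ _ lebesgue_measure `]0, 1[%classic
      (fun t => (h t)^-1) c (fun n => (4 ^+ n)^-1) A) => //.
  - by case=> [|n]; rewrite /c ?invr_ge0 ?(ltW hq)// mulr_ge0 ?exprn_ge0// ltW// weight_gt0.
  - by move=> n t [].
  - move=> n; apply: (@le_trans _ _ (lebesgue_measure `]0, (4 ^+ n)^-1]%classic)).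
      apply: le_measure; rewrite ?inE; [exact: mA|by []|].
      by move=> t [/=]; rewrite !in_itv/= => /andP[-> _].
    by rewrite lebesgue_measure_itv/= lte_fin invr_gt0 exprn_gt0// oppr0 adde0.
  - have B0 : 0 <= B by have /negP := sumB 0%N; rewrite big_geq// -leNgt.
    move=> [|n]; first by rewrite big_geq// addr_ge0 ?invr_ge0 ?mulr_ge0// ltW.
    rewrite big_ltn// /c expr0 invr1 mulr1 lerD2l.
    have -> : \sum_(1 <= i < n.+1) c i / 4 ^+ i = 4 * \sum_(1 <= i < n.+1) weight i.
      rewrite mulr_sumr; apply: eq_big_nat => -[//|i] _.
      by rewrite /c [4 ^+ i.+2]exprS mulrA mulfK ?expf_neq0// mulrC.
    by rewrite ler_wpM2l// leNgt; apply/negP; exact: sumB.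
  - by move=> t; rewrite /= in_itv/= => /h_gt0/ltW; rewrite invr_ge0.
  move=> t /=; rewrite in_itv/= => /andP[t0 t1] _.
  have [|n /andP[n1 n2]] := @expr4_floor R t^-1.
    by rewrite -invr1 lef_pV2 ?posrE// ltW.
  have ht : 0 < h t by rewrite h_gt0// t0.
  have tn : t <= (4 ^+ n)^-1.
    by rewrite -[t]invrK lef_pV2 ?posrE ?invr_gt0 ?exprn_gt0.
  exists n; first by split => //=; rewrite in_itv/= t0.
  case: n n1 n2 tn => [_|n _] n2 tn; rewrite /c.
    rewrite lef_pV2 ?posrE//.
    (* First block, [t] at least [1 / 4]: no weight of index 0 is available since [h] is given on
       []0, 1[] only. The growth of [h t / t ^ beta] yields [h t >= h (1 / 4)]. *)
    have qt : 4^-1 <= t.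
      by rewrite -[t]invrK lef_pV2 ?posrE ?invr_gt0// -[4]expr1 ltW.
    have := @h_incr 4^-1 t; rewrite !in_itv/= q1 t0 t1 => /(_ isT isT qt).
    have b0 : 0 <= beta by case/andP: beta01 => /ltW.
    have p0 : 0 < (4^-1 : R) `^ beta by rewrite powR_gt0.
    have pt : 0 < t `^ beta by rewrite powR_gt0.
    have pp : (4^-1 : R) `^ beta <= t `^ beta.
      by rewrite ge0_ler_powR// nnegrE ltW.
    rewrite ler_pdivrMr// => /le_trans; apply.
    by rewrite mulrAC ler_pdivrMr// ler_wpM2l// ltW.
  have /andP[_ n1] := @expr4V_itv n.+1 isT.
  have := div_h_le t0 tn n1; rewrite -/(weight _) => hw.
  have -> : (h t)^-1 = t / h t * t^-1 by field; rewrite !gt_eqF.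
  apply: ler_pM => //; first by rewrite divr_ge0// ltW.
    by rewrite invr_ge0 ltW.
  exact: ltW.
by move: bound; rewrite h_int leye_eq.
Qed.
End divergence.

(** * The test function *)

Section test_function.
Context {R : realType}.
Variable E : set (R * R).
Hypotheses (E0 : E !=set0) (Ecircle : E `<=` circle) (Eclosed : closed E).
Hypothesis Enull : arclength E = 0%E.
Implicit Types (z w : R * R).

(** The order of the quantifiers matters: [K] depends on [E] alone, so [m] and [N] can be chosen
    after it. *)
Lemma profile_quotient_energy : L2_set E -> exists2 K : R, 0 <= K &
  forall (a : nat -> R) (m N : nat), (m < N)%N ->
    (forall n, (m <= n)%N -> 0 <= a n) ->
    {in [pred n | (m <= n)%N] &, {homo a : i j / (i <= j)%N >-> j <= i}} ->
  forall z, circle z ->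
    (\int[arclength]_(w in circle) (profile_quotient E a m N z w)%:E
      <= (K * profile_energy a m N (dist z E))%:E)%E.
Proof.
move=> [_ [C C0 GC]].
have k0 : 0 <= (4 * 54 * 72 : R) by rewrite !mulr_ge0.
have k1 : 0 <= 16 * C + 32 ^+ 2 * 48 by rewrite addr_ge0 ?mulr_ge0 ?exprn_ge0// ltW.
exists (4 * 54 * 72 + (16 * C + 32 ^+ 2 * 48)); first by rewrite addr_ge0.
move=> a m N mN a_ge0 a_decr z cz.
have mE := measurable_E Eclosed; have mc := @measurable_circle R.
have mq := measurable_profile_quotient E0 Ecircle N a_ge0 z.
pose D := circle `\` E; have mD : measurable D by exact: measurableD.
have Dc : D `<=` circle by move=> w [].
have mqD : measurable_fun D (fun w => (profile_quotient E a m N z w)%:E : \bar R).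
  by apply/measurable_EFinP; exact: measurable_funS mq.
have q0 w : (0 <= (profile_quotient E a m N z w)%:E)%E.
  by rewrite lee_fin profile_quotient_ge0.
rewrite (@ge0_negligible_integral _ _ _ arclength _ E)//; last exact/measurable_EFinP.
pose D1 := D `&` [set w | dist z E <= dist w E].
pose D2 := D `&` [set w | dist w E < dist z E].
have mD1 : measurable D1.
  apply: measurable_fun_le; [exact: mD|exact: measurable_cst|].
  by apply: measurable_funS (measurable_dist E0 Ecircle).
have D2E : D2 = D `\` D1.
  apply/seteqP; split => w [Dw /= h]; split => //=.
    by move=> [_ /=]; rewrite leNgt h.
  by rewrite ltNge; apply/negP => h'; apply: h.
have mD2 : measurable D2 by rewrite D2E; exact: measurableD.
rewrite (@ge0_integral_setU_eq R _ _ arclength D D1 D2)//; first last.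
- by rewrite D2E; apply/disj_setPS => w [? []].
- by rewrite D2E setDUK// => w [].
rewrite mulrDl EFinD; apply: leeD; first exact: integral_profile_far.
(* The L2 condition speaks of [z] off [E]; for [z] in [E] no point is strictly closer to [E], and
   the second region is empty. *)
have [Ez|nEz] := pselect (E z); last first.
  apply: integral_profile_near => //; [exact: ltW|].
  by apply: GC; split.
rewrite (_ : D2 = set0) ?integral_set0.
  by rewrite lee_fin mulr_ge0// profile_energy_ge0.
rewrite -subset0 => w [[cw _]] /=; rewrite (dist_mem E0 Ecircle Ez).
by rewrite ltNge (dist_ge0 E0 Ecircle cw).
Qed.

(** The thickenings decrease to [E], which is closed and null: continuity of arc length from
    above. *)
Lemma arclength_thickening_small (m : nat) (e : R) : 0 < e ->
  exists2 p, (m <= p)%N & (arclength (thickening E (4 / 4 ^+ p)) <= e%:E)%E.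
Proof.
move=> e0; pose F p := thickening E (4 / 4 ^+ p).
have mF p : measurable (F p) by exact: measurable_thickening.
have p4 p : 0 < 4 ^+ p :> R by rewrite exprn_gt0.
have FE : \bigcap_p F p = E.
  apply/seteqP; split => w h; last first.
    move=> p _; split; first exact: Ecircle.
    by rewrite (dist_mem E0 Ecircle h) divr_ge0// ltW.
  have [cw _] := h 0%N I; apply: dist_eq0 => //.
  apply/eqP; rewrite eq_le dist_ge0// andbT leNgt; apply/negP => d0.
  have y0 : 0 <= 4 / dist w E by rewrite divr_ge0// ltW.
  pose n := Num.bound (4 / dist w E).
  have : 4 / dist w E < 4 ^+ n.
    rewrite (lt_le_trans (archi_boundP y0))// -natrX ler_nat ltnW//.
    exact: ltn_expl.
  have [_] := h n I; rewrite ler_pdivlMr// => h1.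
  by rewrite ltr_pdivrMr// mulrC ltNge h1.
have ndF : nonincreasing_seq F.
  move=> i j ij; apply/subsetPset => w [cw h]; split => //.
  by rewrite (le_trans h)// ler_wpM2l// lef_pV2 ?posrE// ler_weXn2l// ler1n.
have F0 : (arclength (F 0%N) < +oo)%E.
  apply: (@le_lt_trans _ _ (arclength (@circle R))).
    by apply: le_measure; rewrite ?inE//; [exact: measurable_circle|move=> w []].
  by rewrite arclength_circle ltry.
have cv : arclength \o F @ \oo --> (0%E : \bar R).
  rewrite -Enull -{1}FE; apply: nonincreasing_cvg_mu => //.
  by rewrite FE; exact: measurable_E.
have : nbhs (0%E : \bar R) [set y | (y < e%:E)%E].
  apply: open_nbhs_nbhs; split; first exact: open_ereal_lt_ereal.
  by rewrite /= lte_fin.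
move=> /cv[p _ pe]; exists (maxn m p); first exact: leq_maxl.
by apply: ltW; apply: pe; exact: leq_maxr.
Qed.

Section fixed_profile.
Variables (a : nat -> R) (m N : nat).
Hypothesis mN : (m < N)%N.
Hypothesis a_ge0 : forall n, (m <= n)%N -> 0 <= a n.
Let S := \sum_(m <= n < N) a n.
Hypothesis S0 : 0 < S.

(** Extended by 0 off the circle to be measurable on the whole plane, where [arclength] lives. *)
Definition test_function : R * R -> R :=
  (fun w => (3 * S)^-1 * profile a m N (dist w E)) \_ circle.

Lemma test_functionE w : circle w ->
  test_function w = (3 * S)^-1 * profile a m N (dist w E).
Proof. by move=> cw; rewrite /test_function patchE mem_set. Qed.

Let S3 : 0 < 3 * S. Proof. by rewrite mulr_gt0. Qed.
Let S3V : 0 <= (3 * S)^-1. Proof. by rewrite invr_ge0 ltW. Qed.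

Lemma test_function_ge0 w : 0 <= test_function w.
Proof.
rewrite /test_function patchE; case: ifP => // _.
by rewrite mulr_ge0 ?profile_ge0.
Qed.

Lemma test_function_le1 w : test_function w <= 1.
Proof.
rewrite /test_function patchE; case: ifP => // _.
by rewrite mulrC ler_pdivrMr// mul1r profile_le.
Qed.

Lemma test_function_eq1 w : circle w -> dist w E <= (4 ^+ N)^-1 ->
  test_function w = 1.
Proof.
by move=> cw wN; rewrite test_functionE// profile_eq// mulVf// gt_eqF.
Qed.

Lemma test_function_tail w p : circle w -> (m <= p <= N)%N -> 4 / 4 ^+ p <= dist w E ->
  test_function w <= (\sum_(m <= n < p) a n) / S.
Proof.
move=> cw pN wp; rewrite test_functionE// mulrC ler_pdivrMr//.
rewrite (le_trans (profile_tail a_ge0 pN wp))//.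
by rewrite mulrCA divfK// gt_eqF.
Qed.

Definition test_function_cst : R :=
  (3 * S)^-1 * \sum_(m <= n < N) a n * 4 ^+ n.

Lemma test_function_cst_ge0 : 0 <= test_function_cst.
Proof.
rewrite mulr_ge0// big_nat_cond; apply: sumr_ge0 => n /andP[/andP[mn _] _].
by rewrite mulr_ge0 ?a_ge0 ?exprn_ge0.
Qed.

Lemma test_function_lipschitz z w : circle z -> circle w ->
  `|test_function z - test_function w| <= test_function_cst * arcdist z w.
Proof.
move=> cz cw; rewrite !test_functionE// -mulrBr normrM ger0_norm// -mulrA.
by rewrite ler_wpM2l// profile_dist_lipschitz.
Qed.

Lemma measurable_test_function : measurable_fun [set: R * R] test_function.
Proof.
apply/(measurable_restrictT _ (@measurable_circle R)).
apply: measurable_funM; first exact: measurable_cst.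
apply: (@lipschitz_measurable_fun _ (\sum_(m <= n < N) a n * 4 ^+ n)).
  rewrite big_nat_cond; apply: sumr_ge0 => n /andP[/andP[mn _] _].
  by rewrite mulr_ge0 ?a_ge0 ?exprn_ge0.
exact: profile_dist_lipschitz.
Qed.

Lemma local_dirichlet_test_function (B : R) z : circle z ->
  (\int[arclength]_(w in circle) (profile_quotient E a m N z w)%:E <= B%:E)%E ->
  (0 <= local_dirichlet test_function z <= ((3 * S) ^- 2 * B)%:E)%E.
Proof.
move=> cz qB.
rewrite (local_dirichlet_lipschitz test_function_cst_ge0 test_function_lipschitz)//.
have -> : (\int[arclength]_(w in circle)
      (`|test_function w - test_function z| ^+ 2 / modulus (w - z) ^+ 2)%:E =
    ((3 * S) ^- 2)%:E *
      \int[arclength]_(w in circle) (profile_quotient E a m N z w)%:E)%E.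
  rewrite -ge0_integralZl_EFin//; first last.
  - by rewrite invr_ge0 sqr_ge0.
  - by apply/measurable_EFinP; exact: measurable_profile_quotient.
  - by move=> w _; rewrite lee_fin profile_quotient_ge0.
  - exact: measurable_circle.
  apply: eq_integral => w /set_mem cw; rewrite -EFinM; congr EFin.
  rewrite !test_functionE// -mulrBr normrM (ger0_norm S3V) /profile_quotient.
  by rewrite exprMn -[LHS]mulrA exprVn.
have q0 : (0 <= \int[arclength]_(w in circle) (profile_quotient E a m N z w)%:E)%E.
  by apply: integral_ge0 => w _; rewrite lee_fin profile_quotient_ge0.
have p0 : 0 <= (pi *+ 2)^-1 :> R by rewrite invr_ge0 mulrn_wge0// pi_ge0.
have p1 : (pi *+ 2)^-1 <= 1 :> R.
  rewrite invf_le1; last by rewrite mulrn_wgt0// pi_gt0.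
  by rewrite mulr2n; have := pi_ge2 R; lra.
have S20 : 0 <= (3 * S) ^- 2 by rewrite invr_ge0 sqr_ge0.
apply/andP; split.
  by apply: mule_ge0; rewrite ?lee_fin//; apply: mule_ge0; rewrite ?lee_fin.
rewrite -[leRHS]mul1e EFinM; apply: lee_pmul; rewrite ?lee_fin ?mule_ge0 ?lee_fin//.
by apply: lee_pmul; rewrite ?lee_fin.
Qed.

(** The value at the origin is the mean over the circle: the function is at most 1 on a thickening
    of length at most [e], and at most the tail ratio elsewhere. *)
Lemma poisson_test_function (p : nat) (e : R) : (m <= p <= N)%N ->
  (arclength (thickening E (4 / 4 ^+ p)) <= e%:E)%E ->
  0 <= poisson test_function (0, 0) <= e + (\sum_(m <= n < p) a n) / S.
Proof.
move=> mpN pe; have /andP[mp _] := mpN.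
set delta := _ / S.
have delta0 : 0 <= delta.
  rewrite divr_ge0 ?(ltW S0)// big_nat_cond; apply: sumr_ge0 => n /andP[/andP[mn _] _].
  exact: a_ge0.
have p0 : 0 < pi *+ 2 :> R by rewrite mulrn_wgt0// pi_gt0.
have p1 : 1 <= pi *+ 2 :> R by rewrite mulr2n; have := pi_ge2 R; lra.
pose T := thickening E (4 / 4 ^+ p).
have mT : measurable T by exact: measurable_thickening.
have e0 : 0 <= e by rewrite -lee_fin (le_trans (measure_ge0 arclength T)).
pose k w := (1 - modulus (0, 0) ^+ 2) / modulus (w - (0, 0)) ^+ 2 * test_function w.
have kE w : circle w -> k w = test_function w.
  move=> cw; rewrite /k.
  have -> : w - (0, 0) = w by rewrite [RHS]surjective_pairing; congr pair; rewrite /= subr0.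
  rewrite (cw : modulus w = 1) /modulus /= expr0n/= addr0 sqrtr0 expr0n/= subr0.
  by rewrite expr1n divr1 mul1r.
have k0 w : circle w -> 0 <= k w by move=> cw; rewrite kE// test_function_ge0.
have I0 : (0 <= \int[arclength]_(w in circle) (k w)%:E)%E.
  by apply: integral_ge0 => w cw; rewrite lee_fin k0.
have I1 : (\int[arclength]_(w in circle) (k w)%:E <= (e + delta * pi *+ 2)%:E)%E.
  apply: (@le_trans _ _ (\int[arclength]_(w in circle) ((\1_T w)%:E + delta%:E))%E).
    apply: ge0_le_integral_nonmeasurable => w cw; first by rewrite lee_fin k0.
    rewrite -EFinD lee_fin kE// indicE; have [wT|wT] := boolP (w \in T).
      by rewrite (le_trans (test_function_le1 w))// lerDl.
    rewrite add0r; apply: test_function_tail => //.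
    move: wT; rewrite notin_setE /T /thickening/= => /not_andP[//|].
    by move=> /negP; rewrite -ltNge => /ltW.
  have mc := @measurable_circle R.
  rewrite ge0_integralD//; last first.
    by apply/measurable_EFinP; exact: measurable_indic.
  rewrite integral_indic// integral_cst// setIidl; last by move=> w [].
  by rewrite [X in (_ * X)%E]arclength_circle (EFinD e) leeD// -EFinM mulrnAr.
have -> : poisson test_function (0, 0) =
    (pi *+ 2)^-1 * fine (\int[arclength]_(w in circle) (k w)%:E) by [].
(* [poisson] takes the real part [fine] of the integral, which carries information only once the
   integral is known to be finite. *)
have [r rE] : exists r : R, (\int[arclength]_(w in circle) (k w)%:E = r%:E)%E.
  by move: I0 I1; case: (integral _ _ _) => // r; exists r.
move: I0 I1; rewrite rE /= !lee_fin => r0 r1.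
apply/andP; split; first by rewrite mulr_ge0// invr_ge0 ltW.
rewrite ler_pdivrMl// (le_trans r1)// [leRHS]mulrDr lerD//.
  by rewrite ler_peMl.
by rewrite le_eqVlt; apply/orP; left; apply/eqP; ring.
Qed.

Lemma test_function_Lfun : test_function \in Lfun arclength 2%:E.
Proof.
have fin : (arclength [set: R * R] < +oo)%E by rewrite arclength_setT ltry.
apply: bounded_Lfun2; first exact: fin.
- exact: measurable_test_function.
- by move=> w; rewrite ger0_norm ?test_function_ge0 ?test_function_le1.
Qed.

End fixed_profile.
End test_function.

(** * Capacity *)

Section capacity_bounds.
Context {R : realType}.
Variable E : set (R * R).
Hypotheses (E0 : E !=set0) (Ecircle : E `<=` circle) (Eclosed : closed E).
Implicit Types (mu : {finite_measure set (R * R)%type -> \bar R}).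

Lemma capacity_ge0 (mu : {measure set (R * R)%type -> \bar R}) (F : set (R * R)) :
  (0 <= capacity mu F)%E.
Proof.
apply: le_ereal_inf_tmp => _ [U _ <-]; apply: le_ereal_inf_tmp => _ [f _ <-].
apply: adde_ge0; first by rewrite lee_fin sqr_ge0.
apply: integral_ge0 => z _; rewrite /local_dirichlet; case: ifP => // _.
rewrite mule_ge0//; first by rewrite lee_fin invr_ge0 mulrn_wge0// pi_ge0.
by apply: integral_ge0 => w _; rewrite lee_fin divr_ge0 ?sqr_ge0.
Qed.

(** Capacity is an infimum over open sets, so the test function must be 1 on a neighbourhood of [E].
    The radius is [r / 2] because an arc is at most twice its chord. *)
Lemma circle_open_neighborhood (r : R) : 0 < r ->
  exists2 U, circle_open U /\ E `<=` U & forall w, U w -> circle w /\ dist w E <= r.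
Proof.
move=> r0; pose V := \bigcup_(e in E) euclidean_ball e (r / 2).
exists (circle `&` V); first split.
- by exists V => //; apply: bigcup_open => e _; exact: open_euclidean_ball.
- move=> e Ee; split; first exact: Ecircle.
  exists e => //; rewrite /euclidean_ball/= subrr /modulus/= expr0n/= addr0 sqrtr0.
  by rewrite divr_gt0.
move=> w [cw [e Ee /= we]]; split => //.
have := arcdist_le_modulus cw (Ecircle Ee); have := dist_le Ecircle cw Ee.
by move: we; rewrite /euclidean_ball/=; lra.
Qed.

Lemma profile_energyE (a : nat -> R) (m N : nat) z : circle z ->
  profile_energy a m N (dist z E) = \sum_(m <= n < N)
    a n ^+ 2 * 4 ^+ n * \1_(thickening E (4 / 4 ^+ n)) z + a m ^+ 2 * 4 ^+ m.
Proof.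
move=> cz; congr (_ + _); apply: eq_bigr => n _; rewrite indicE.
have -> // : (dist z E <= 4 / 4 ^+ n) = (z \in thickening E (4 / 4 ^+ n)).
by apply/idP/idP => [h|/set_mem[]//]; apply/mem_set.
Qed.

Lemma measurable_profile_energy (a : nat -> R) (m N : nat) :
  measurable_fun circle (fun z => profile_energy a m N (dist z E)).
Proof.
apply: (eq_measurable_fun (fun z => \sum_(m <= n < N)
    a n ^+ 2 * 4 ^+ n * \1_(thickening E (4 / 4 ^+ n)) z + a m ^+ 2 * 4 ^+ m)).
  by move=> z /set_mem cz; rewrite profile_energyE.
apply: measurable_funD; last exact: measurable_cst.
apply: measurable_sum => n; apply: measurable_funM; first exact: measurable_cst.
by apply: measurable_indic; exact: measurable_thickening.
Qed.

Lemma integral_profile_energy mu (a : nat -> R) (m N : nat) (M : R) :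
  (forall n, (m <= n)%N -> 0 <= a n) ->
  (forall n, (m <= n)%N ->
    a n * 4 ^+ n * fine (mu (thickening E (4 / 4 ^+ n))) <= M) ->
  (\int[mu]_(z in circle) (profile_energy a m N (dist z E))%:E <=
    (M * \sum_(m <= n < N) a n + a m ^+ 2 * 4 ^+ m * fine (mu circle))%:E)%E.
Proof.
move=> a_ge0 aM; have mc := @measurable_circle R.
pose T n := thickening E (4 / 4 ^+ n).
have mT n : measurable (T n) by exact: measurable_thickening.
have c0 n : 0 <= a n ^+ 2 * 4 ^+ n by rewrite mulr_ge0 ?sqr_ge0 ?exprn_ge0.
have mI n : measurable_fun circle (fun z => (\1_(T n) z)%:E : \bar R).
  by apply/measurable_EFinP; exact: measurable_indic.
pose G n z : \bar R := ((a n ^+ 2 * 4 ^+ n)%:E * (\1_(T n) z)%:E)%E.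
have G0 n z : (0 <= G n z)%E by rewrite mule_ge0// lee_fin.
have mG n : measurable_fun circle (G n) by exact: measurable_funeM.
have -> : (\int[mu]_(z in circle) (profile_energy a m N (dist z E))%:E =
    \int[mu]_(z in circle) (\sum_(m <= n < N) G n z + (a m ^+ 2 * 4 ^+ m)%:E))%E.
  apply: eq_integral => z /set_mem cz; rewrite profile_energyE// EFinD -sumEFin.
  by congr (_ + _)%E; apply: eq_bigr => n _; rewrite EFinM.
rewrite ge0_integralD//; first last.
- by move=> z _; rewrite lee_fin.
- exact: emeasurable_sum.
- by move=> z _; exact: sume_ge0.
rewrite ge0_integral_sum// integral_cst// EFinD; apply: leeD; last first.
  by rewrite -[X in (_ * X <= _)%E]fineK ?fin_num_measure// -EFinM.
rewrite mulr_sumr -sumEFin; rewrite big_nat_cond [leRHS]big_nat_cond.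
apply: lee_sum => n /andP[/andP[mn _] _].
rewrite ge0_integralZl_EFin// integral_indic// setIidl; last by move=> z [].
rewrite -[X in (_ * X)%E]fineK ?fin_num_measure// -EFinM lee_fin.
rewrite expr2 -!mulrA mulrC; rewrite mulrA ler_wpM2r ?a_ge0//.
by rewrite -mulrA mulrA aM.
Qed.

End capacity_bounds.

Section weight_tail.
Context {R : realType}.
Variables (h : R -> R) (beta : R).
Hypothesis h_gt0 : forall t : R, 0 < t < 1 -> 0 < h t.
Hypothesis beta01 : 0 < beta < 1.
Hypothesis h_decr : {in `]0, 1[ &, {homo (fun t => h t / t) : s t /~ s <= t}}.
Hypothesis h_incr :
  {in `]0, 1[ &, {homo (fun t => h t / t `^ beta) : s t / s <= t}}.
Hypothesis h_int :
  (\int[lebesgue_measure]_(t in `]0%R, 1%R[) ((h t)^-1)%:E = +oo)%E.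

(** The sum from 1 is pushed beyond [|B|] plus the weights before [p]: this forces [N] past [p], and
    removing the weights before [m] still leaves more than [B]. *)
Lemma weight_tail_unbounded (m p : nat) (B : R) : (0 < m)%N -> (m <= p)%N ->
  exists2 N, (p < N)%N & B < \sum_(m <= n < N) weight h n.
Proof.
move=> m0 mp.
have w0 n : (0 < n)%N -> 0 <= weight h n by move=> n0; rewrite ltW// weight_gt0.
have [N BN] := weight_sum_unbounded h_gt0 beta01 h_decr h_incr h_int
  (`|B| + \sum_(1 <= n < p) weight h n).
have pN : (p < N)%N.
  rewrite ltnNge; apply/negP => Np; move: BN; rewrite ltNge => /negP; apply.
  apply: (@le_trans _ _ (\sum_(1 <= n < p) weight h n)); last by rewrite lerDr.
  have [N0|N0] := leqP N 1.
    rewrite big_geq// big_nat_cond; apply: sumr_ge0 => n /andP[/andP[n0 _] _].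
    exact: w0.
  rewrite [leRHS](big_cat_nat (n := N))//=; last exact: ltnW.
  rewrite lerDl big_nat_cond; apply: sumr_ge0 => n /andP[/andP[Nn _] _].
  by apply: w0; apply: leq_trans Nn; exact: ltnW.
exists N => //.
have BN' : `|B| + \sum_(1 <= n < m) weight h n < \sum_(1 <= n < N) weight h n.
  apply: le_lt_trans BN; rewrite lerD2l [leRHS](big_cat_nat (n := m))//=.
  rewrite lerDl big_nat_cond; apply: sumr_ge0 => n /andP[/andP[mn _] _].
  by apply: w0; exact: leq_trans mn.
move: BN'; rewrite [X in _ < X](big_cat_nat (n := m))//=; last first.
  by rewrite ltnW// (leq_ltn_trans mp).
have := ler_norm B; lra.
Qed.

(** Here [weight h n * 4 ^+ n] is [1 / h (4 ^- n)], whereas [f] is read at a point 4 times larger.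
    The factor 4 is the doubling bound given by [div_h_le], for which [n > 1] keeps that point below
    1. *)
Lemma weight_growth (f : R -> R) (M d : R) (n : nat) : 0 <= M ->
  (forall t, 0 < t < d -> f t <= M * h t) -> (1 < n)%N -> 4 / 4 ^+ n < d ->
  weight h n * 4 ^+ n * f (4 / 4 ^+ n) <= 4 * M.
Proof.
move=> M0 fM n1 nd; have n0 : (0 < n)%N by exact: ltnW.
have p4 : 0 < 4 ^+ n :> R by rewrite exprn_gt0.
have t0 : 0 < 4 / 4 ^+ n :> R by rewrite divr_gt0.
have hs : 0 < h (4 ^+ n)^-1 by rewrite h_gt0// expr4V_itv.
have t1 : 4 / 4 ^+ n < 1 :> R.
  rewrite ltr_pdivrMr// mul1r -[X in X < _]expr1 ltr_eXn2l// ltr1n//.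
have ht : 0 < h (4 / 4 ^+ n) by rewrite h_gt0// t0.
have st : (4 ^+ n)^-1 <= 4 / 4 ^+ n :> R by rewrite ler_peMl ?invr_ge0 ?(ltW p4)// ler1n.
have q0 : 0 < (4 ^+ n)^-1 :> R by rewrite invr_gt0.
have htt : h (4 / 4 ^+ n) <= 4 * h (4 ^+ n)^-1.
  have := div_h_le h_gt0 h_decr q0 st t1; rewrite ler_pdivlMr//.
  by rewrite mulrAC -mulrA mulrC ler_pM2r// ler_pdivrMr.
have -> : weight h n * 4 ^+ n = (h (4 ^+ n)^-1)^-1.
  by rewrite /weight mulrAC mulVf ?mul1r// gt_eqF.
rewrite ler_pdivrMl// (le_trans (fM _ _)) ?t0//.
rewrite (_ : h (4 ^+ n)^-1 * _ = M * (4 * h (4 ^+ n)^-1)); last by ring.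
by rewrite ler_wpM2l.
Qed.
End weight_tail.

Theorem theorem6p3 (R : realType)
    (mu : {finite_measure set (R * R)%type -> \bar R})
    (mu_circle : mu (~` circle) = 0%E)
    (E : set (R * R)) (E_L2 : L2_set E)
    (h : R -> R) (beta : R)
    (h_gt0 : forall t : R, 0 < t < 1 -> 0 < h t)
    (muE_h : (fun t : R => fine (mu (thickening E t))) =O_ (0^'+) h)
    (beta01 : 0 < beta < 1)
    (h_decr : {in `]0, 1[ &, {homo (fun t => h t / t) : s t /~ s <= t}})
    (h_incr : {in `]0, 1[ &, {homo (fun t => h t / t `^ beta) : s t / s <= t}})
    (h_int : (\int[lebesgue_measure]_(t in `]0%R, 1%R[) ((h t)^-1)%:E = +oo)%E) :
  capacity mu E = 0%E.
Proof.
have [[E0 Ecircle Eclosed Enull _] _] := E_L2.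
have [K K0 HK] := profile_quotient_energy E0 Ecircle Eclosed Enull E_L2.
have /eqO_exP[M M0 [d /= d0 dM]] := muE_h.
have fM t : 0 < t < Num.min d 1 -> fine (mu (thickening E t)) <= M * h t.
  rewrite lt_min => /and3P[t0 td t1].
  have := dM t; rewrite /= sub0r normrN gtr0_norm// => /(_ td t0).
  by rewrite (gtr0_norm (h_gt0 _ _)) ?t0//; apply: le_trans; exact: ler_norm.
(* From [m] on, all radii [4 / 4 ^+ n] lie where the bound on [mu] holds. *)
have [m m1 md] : exists2 m, (1 < m)%N & forall n, (m <= n)%N -> 4 / 4 ^+ n < Num.min d 1.
  have dd : 0 < Num.min d 1 by rewrite lt_min d0 ltr01.
  exists (maxn 2 (Num.bound (4 / Num.min d 1))); first by rewrite leq_max.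
  move=> n; rewrite geq_max => /andP[_ bn].
  rewrite ltr_pdivrMr ?exprn_gt0// mulrC -ltr_pdivrMr//.
  rewrite (lt_le_trans (archi_boundP _)) ?divr_ge0 ?(ltW dd)//.
  by rewrite -natrX ler_nat (leq_trans bn)// ltnW// ltn_expl.
have m0 : (0 < m)%N by exact: ltnW.
pose a := weight h.
have a_ge0 n : (m <= n)%N -> 0 <= a n.
  by move=> mn; rewrite ltW// weight_gt0// (leq_trans m0).
have a_decr : {in [pred n | (m <= n)%N] &, {homo a : i j / (i <= j)%N >-> j <= i}}.
  move=> i j mi mj; apply: weight_decr => //; first exact: leq_trans mi.
  exact: leq_trans mj.
pose b := a m ^+ 2 * 4 ^+ m * fine (mu circle).
have b0 : 0 <= b by rewrite mulr_ge0 ?fine_ge0// mulr_ge0 ?sqr_ge0 ?exprn_ge0.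
have Imu N : (\int[mu]_(z in circle) (profile_energy a m N (dist z E))%:E
    <= (4 * M * \sum_(m <= n < N) a n + b)%:E)%E.
  apply: integral_profile_energy => // n mn.
  apply: (@weight_growth _ _ h_gt0 h_decr (fun t => fine (mu (thickening E t))) _
    (Num.min d 1)) => //; [exact: ltW|exact: leq_trans mn|exact: md].
apply/eqP; rewrite eq_le capacity_ge0 andbT.
apply/lee_addgt0Pr => eps eps0; rewrite add0e.
(* The energy will be at most [e] and the value at the origin at most [2 * e], whose square is at
   most [4 * e] as [e <= 1]: in total [5 * e]. *)
pose e := Num.min 1 (eps / 5).
have e0 : 0 < e by rewrite lt_min ltr01 divr_gt0.
have e1 : e <= 1 by rewrite ge_min lexx.
have e5 : 5 * e <= eps by rewrite -ler_pdivlMl// mulrC ge_min lexx orbT.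
have [p mp pe] := arclength_thickening_small E0 Ecircle Eclosed Enull m e0.
pose Sp := \sum_(m <= n < p) a n.
have Sp0 : 0 <= Sp.
  by rewrite /Sp big_nat_cond; apply: sumr_ge0 => n /andP[/andP[mn _] _]; exact: a_ge0.
have Q0 : 0 <= K * (4 * M + b) by rewrite mulr_ge0// addr_ge0// mulr_ge0// ltW.
(* With [p] and [Sp] fixed, one lower bound on [S] serves three purposes: [S >= 1], a tail ratio
   [Sp / S] at most [e], and an energy at most [e]. *)
have [N pN SN] := weight_tail_unbounded h_gt0 beta01 h_decr h_incr h_int
  (1 + Sp / e + K * (4 * M + b) / e) m0 mp.
set S := \sum_(m <= n < N) weight h n in SN.
have mN : (m < N)%N by exact: leq_ltn_trans pN.
have Spe : 0 <= Sp / e by rewrite divr_ge0// ltW.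
have Qe : 0 <= K * (4 * M + b) / e by rewrite divr_ge0// ltW.
have [S1 SpeS QeS] : [/\ 1 <= S, Sp / e <= S & K * (4 * M + b) / e <= S].
  by move: SN Spe Qe; set x := Sp / e; set y := _ / e; split; lra.
have S0 : 0 < S by exact: lt_le_trans S1.
have SpS : Sp / S <= e by rewrite ler_pdivrMr// mulrC -ler_pdivrMr.
have QS : K * (4 * M + b) / S <= e by rewrite ler_pdivrMr// [leRHS]mulrC -ler_pdivrMr.
pose f := test_function E a m N.
have local z : circle z -> (0 <= local_dirichlet f z <=
    ((3 * S) ^- 2 * (K * profile_energy a m N (dist z E)))%:E)%E.
  move=> cz; apply: local_dirichlet_test_function => //; exact: HK.
have dirichlet_f : (dirichlet mu f <= e%:E)%E.
  apply: (@le_trans _ _ (\int[mu]_(z in circle)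
      (((3 * S) ^- 2 * K)%:E * (profile_energy a m N (dist z E))%:E))%E).
    apply: ge0_le_integral_nonmeasurable => z /local /andP[]// _.
    by rewrite -EFinM -mulrA.
  have mc := @measurable_circle R.
  rewrite ge0_integralZl_EFin//; first last.
  - by rewrite mulr_ge0// invr_ge0 sqr_ge0.
  - by apply/measurable_EFinP; exact: measurable_profile_energy.
  - by move=> z _; rewrite lee_fin profile_energy_ge0.
  apply: (@le_trans _ _ (((3 * S) ^- 2 * K)%:E * (4 * M * S + b)%:E)%E).
    rewrite lee_pmul//; first by rewrite lee_fin mulr_ge0// invr_ge0 sqr_ge0.
    by apply: integral_ge0 => z _; rewrite lee_fin profile_energy_ge0.
  rewrite -EFinM lee_fin (le_trans _ QS)//.
  (* Since [S >= 1], the constant [b] is absorbed into [b * S]; dividing by [(3 * S) ^+ 2] then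
     leaves one factor [S] in the denominator. *)
  have h1 : K * (4 * M * S + b) <= K * (4 * M + b) * S.
    by rewrite -[leRHS]mulrA ler_wpM2l// [leRHS]mulrDl lerD2l ler_peMr.
  have h2 : 0 <= (3 * S) ^- 2 by rewrite invr_ge0 sqr_ge0.
  rewrite -[leLHS]mulrA (le_trans (ler_wpM2l h2 h1))//.
  have -> : (3 * S) ^- 2 * (K * (4 * M + b) * S) = K * (4 * M + b) / S / 9.
    by field; rewrite gt_eqF.
  by rewrite ler_pdivrMr// ler_peMr ?ler1n// divr_ge0// ltW.
have q0 : 0 < (4 ^+ N)^-1 :> R by rewrite invr_gt0 exprn_gt0.
have [U [oU EU] UE] := circle_open_neighborhood Ecircle q0.
have normf : (normsq mu f <= eps%:E)%E.
  rewrite /normsq.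
  have /andP[P0 P1] : 0 <= poisson f (0, 0) <= e + Sp / S.
    by apply: poisson_test_function => //; rewrite mp ltnW.
  apply: (@le_trans _ _ ((4 * e)%:E + e%:E)%E).
    apply: leeD => //; rewrite lee_fin ger0_norm//.
    have : poisson f (0, 0) <= 2 * e by lra.
    nra.
  by rewrite -EFinD lee_fin; lra.
apply: (@le_trans _ _ (capacity_open mu U)).
  by apply: ereal_inf_lbound; exists U.
apply: le_trans normf; apply: ereal_inf_lbound; exists f => //; split.
- split; first exact: test_function_Lfun.
  by rewrite (le_lt_trans dirichlet_f) ?ltry.
- by apply: aeW => z; exact: test_function_ge0.
- by apply: aeW => z /UE[cz zN]; rewrite /f test_function_eq1.
Qed.
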